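(* Let $M$ be a finite right Fountain monoid and $k$ a field whose characteristic does not divide the order of any maximal subgroup of $M$. Let $e_1,\ldots,e_n$ be a complete set of idempotent representatives of the regular $\mathcal J$-classes of $M$. Then the following are equivalent. (1) Each sandwich matrix of the $\mathcal J$-class $J_{e_i}$ is right invertible over $kG_{e_i}$, for $i=1,\ldots,n$. (2) Each coinduced module $\mathrm{Coind}_{G_{e_i}}(V)$ with $V$ a simple $kG_{e_i}$-module is simple, for $i=1,\ldots,n$. (3) For each $i=1,\ldots,n$ and each simple $kG_{e_i}$-module $V$, the projective cover of the simple $kM$-module $V^\sharp$ associated to $V$ is $k\widetilde L_{e_i}\otimes_{kG_{e_i}}V$.
   Context: Green's relations on a monoid $M$: $m\,\mathcal L\,n$ iff $Mm=Mn$; $m\,\mathcal R\,n$ iff $mM=nM$; $m\,\mathcal J\,n$ iff $MmM=MnM$. $L_m,R_m,J_m$ are the classes of $m$. $E(M)$ is the set of idempotents; a $\mathcal J$-class is regular if it contains an idempotent. For $e\in E(M)$, $G_e$ is the group of units of $eMe$, called the maximal subgroup of $M$ at $e$. All modules are finite dimensional left modules unless stated otherwise. Define $m\,\widetilde{\mathcal L}\,n$ iff for all $e\in E(M)$: $me=m\iff ne=n$. $\widetilde L_m$ is the $\widetilde{\mathcal L}$-class of $m$. $M$ is right Fountain if every $\widetilde{\mathcal L}$-class contains an idempotent. For $e\in E(M)$, $k\widetilde L_e$ (vector space with basis $\widetilde L_e$) is a left $kM$-module via $m\cdot x=mx$ if $mx\in\widetilde L_e$ and $m\cdot x=0$ otherwise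 ($m\in M,x\in\widetilde L_e$); for $M$ finite right Fountain, $G_e$ acts on the right of $\widetilde L_e$ by right multiplication, making $k\widetilde L_e$ a $kM$-$kG_e$-bimodule. $kR_e$ is a $kG_e$-$kM$-bimodule: $G_e$ acts by left multiplication, and $r\cdot m=rm$ if $rm\in R_e$, $r\cdot m=0$ otherwise. For a $kG_e$-module $V$, $\mathrm{Coind}_{G_e}(V)=\mathrm{Hom}_{kG_e}(kR_e,V)$ with $(m\varphi)(r)=\varphi(rm)$. If $V$ is simple, $V^\sharp$ denotes the socle of $\mathrm{Coind}_{G_e}(V)$, which is a simple $kM$-module; every simple $kM$-module is isomorphic to $V^\sharp$ for exactly one pair $(i,[V])$ with $V$ a simple $kG_{e_i}$-module. Sandwich matrix of a regular $\mathcal J$-class $J$ with $e\in E(J)$: let $A$ be the set of $\mathcal R$-classes and $B$ the set of $\mathcal L$-classes of $J$; choose $\rho_a\in L_e\cap a$ for $a\in A$ and $\lambda_b\in R_e\cap b$ for $b\in B$. The sandwich matrix is the $B\times A$ matrix $P$ with $P(b,a)=\lambda_b\rho_a$ if $\lambda_b\rho_a\in G_e$ and $P(b,a)=0$ otherwise. Right invertibility over $kG_e$ (existence of an $A\times B$ matrix $Q$ over $kG_e$ with $PQ=I$) does not depend on the choices made. The projective cover of a simple module $S$ is the unique (up to isomorphism) projective indecomposable module $P$ with $P/\mathrm{rad}(P)\cong S$. *)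

(* Defs.v *)
From HB Require Import structures.
From mathcomp Require Import all_boot.
From Stdlib Require Import Classical ClassicalEpsilon.

Set Implicit Arguments.
Unset Strict Implicit.
Unset Printing Implicit Defensive.

(* Declared before fingroup is loaded: Hierarchy-Builder does not accept a
   structure lying between Monoid and FinGroup once the latter is known. *)
#[short(type="finMonoidType")]
HB.structure Definition FinMonoid := { M of monoid.Monoid M & Finite M }.

From mathcomp Require Import all_order all_fingroup all_algebra zify.

Import GRing.Theory.

Local Open Scope ring_scope.

Section Green.
Variable M : finMonoidType.
Implicit Types m n x y : M.

Definition greenL m n : bool :=
  [set (x * m)%g | x in [set: M]] == [set (x * n)%g | x in [set: M]].
Definition greenR m n : bool :=
  [set (m * x)%g | x in [set: M]] == [set (n * x)%g | x in [set: M]].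
Definition greenJ m n : bool :=
  [set (x * m * y)%g | x in [set: M], y in [set: M]]
    == [set (x * n * y)%g | x in [set: M], y in [set: M]].

Definition Lclass m : {set M} := [set n | greenL m n].
Definition Rclass m : {set M} := [set n | greenR m n].
Definition Jclass m : {set M} := [set n | greenJ m n].

Definition idempotent m : bool := (m * m)%g == m.

Definition regularJ m : bool := [exists f in Jclass m, idempotent f].

Definition Ltilde m n : bool :=
  [forall e : M, idempotent e ==> (((m * e)%g == m) == ((n * e)%g == n))].
Definition Ltclass m : {set M} := [set n | Ltilde m n].

Definition right_fountain : bool :=
  [forall m : M, [exists f in Ltclass m, idempotent f]].

Definition idem := {e : M | idempotent e}.

Lemma idemE (e : idem) : (val e * val e = val e)%g.
Proof. exact/eqP/(valP e). Qed.

Definition units_at (e : M) : {set M} :=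
  [set g | ((e * g * e)%g == g)
     && [exists h, [&& (e * h * e)%g == h, (g * h)%g == e & (h * g)%g == e]]].

Definition maxsub (e : idem) := {g : M | g \in units_at (val e)}.
HB.instance Definition _ (e : idem) := SubFinite.on (maxsub e).

End Green.

Arguments right_fountain M : clear implicits.
Arguments idem M : clear implicits.

Section MaxSubgroup.
Variables (M : finMonoidType) (e : idem M).
Local Notation E := (val e).
Implicit Types g h : maxsub e.

Lemma unitsP (g : M) :
  reflect ((E * g * E)%g = g /\
           exists h : M, [/\ (E * h * E)%g = h, (g * h)%g = E & (h * g)%g = E])
          (g \in units_at E).
Proof.
rewrite inE; apply: (iffP andP) => [[/eqP-> /existsP[h /and3P[/eqP ? /eqP ? /eqP ?]]]|].
  by split=> //; exists h.
case=> g1 [h [h1 h2 h3]]; split; first exact/eqP.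
by apply/existsP; exists h; rewrite h1 h2 h3 !eqxx.
Qed.

Lemma unit_mull g : (E * val g = val g)%g.
Proof. by have /unitsP[<- _] := valP g; rewrite !mulgA idemE. Qed.

Lemma unit_mulr g : (val g * E = val g)%g.
Proof. by have /unitsP[<- _] := valP g; rewrite -!mulgA idemE. Qed.

Fact maxsub_mul_subproof g h : (val g * val h)%g \in units_at E.
Proof.
have /unitsP[_ [g' [g'E gg' g'g]]] := valP g.
have /unitsP[_ [h' [h'E hh' h'h]]] := valP h.
apply/unitsP; split; first by rewrite mulgA unit_mull -mulgA unit_mulr.
exists (h' * g')%g.
have lh' : (E * h' = h')%g by rewrite -h'E !mulgA idemE.
have rh' : (h' * E = h')%g by rewrite -h'E -!mulgA idemE.
have rg' : (g' * E = g')%g by rewrite -g'E -!mulgA idemE.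
split.
- by rewrite !mulgA lh' -mulgA rg'.
- by rewrite mulgA -(mulgA (val g)) hh' unit_mulr.
- by rewrite mulgA -(mulgA h') g'g rh'.
Qed.

Fact maxsub_one_subproof : E \in units_at E.
Proof. by apply/unitsP; split; [|exists E]; rewrite !idemE. Qed.

Definition maxsub_invM (g : maxsub e) : M :=
  odflt E [pick h : M | [&& (E * h * E)%g == h, (val g * h)%g == E
                      & (h * val g)%g == E]].

Lemma maxsub_invMP g : [/\ (E * maxsub_invM g * E)%g = maxsub_invM g,
  (val g * maxsub_invM g)%g = E & (maxsub_invM g * val g)%g = E].
Proof.
rewrite /maxsub_invM; case: pickP => [h /and3P[/eqP ? /eqP ? /eqP ?] //|H].
have /unitsP[_ [h [h1 h2 h3]]] := valP g.
by have := H h; rewrite h1 h2 h3 !eqxx.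
Qed.

Fact maxsub_inv_subproof g : maxsub_invM g \in units_at E.
Proof.
have [h1 h2 h3] := maxsub_invMP g; apply/unitsP; split=> //.
by exists (val g); rewrite unit_mull unit_mulr.
Qed.

Definition maxsub_mul g h : maxsub e := exist _ (val g * val h)%g (maxsub_mul_subproof g h).
Definition maxsub_one : maxsub e := exist _ E maxsub_one_subproof.
Definition maxsub_inv g : maxsub e := 
  exist _ (maxsub_invM g) (maxsub_inv_subproof g).

Fact maxsub_mulA : associative maxsub_mul.
Proof. by move=> x y z; apply: val_inj; rewrite /= mulgA. Qed.
Fact maxsub_mul1 : left_id maxsub_one maxsub_mul.
Proof. by move=> x; apply: val_inj; rewrite /= unit_mull. Qed.
Fact maxsub_mulV : left_inverse maxsub_one maxsub_inv maxsub_mul.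
Proof. by move=> x; apply: val_inj; case: (maxsub_invMP x). Qed.

HB.instance Definition _ :=
  Finite_isGroup.Build (maxsub e) maxsub_mulA maxsub_mul1 maxsub_mulV.

Lemma val_maxsubM g h : val (g * h)%g = (val g * val h)%g.
Proof. by []. Qed.

Lemma val_maxsub1 : val (1%g : maxsub e) = E.
Proof. by []. Qed.

End MaxSubgroup.

Section LtildeMaxsub.
Variables (M : finMonoidType) (e : idem M).
Local Notation E := (val e).

Lemma LtildeP (m n : M) :
  reflect (forall f, idempotent f -> (m * f = m <-> n * f = n)%g) (Ltilde m n).
Proof.
apply: (iffP forallP) => [H f If|H f].
  by have /eqP Hf := implyP (H f) If; split=> /eqP X; apply/eqP; move: X;
    rewrite Hf.
apply/implyP=> /H[H1 H2]; apply/eqP.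
by apply/idP/idP=> /eqP; [move/H1|move/H2]=> /eqP.
Qed.

Lemma idempotent_pow (x : M) : exists n, idempotent (x ^+ n.+1)%g.
Proof.
have [i [p [p0 ip]]] : exists i p, (0 < p)%N /\ (x ^+ (i + p) = x ^+ i)%g.
  have /injectivePn[i [j ij xij]] :
      ~~ injectiveb (fun i : 'I_(#|M|.+1) => (x ^+ i)%g).
    apply/injectiveP=> /(leq_card _); rewrite card_ord.
    by rewrite ltnn.
  have [lt|lt|eq] := ltngtP i j; last by rewrite (val_inj eq) eqxx in ij.
    by exists i, (j - i)%N; rewrite subn_gt0 subnKC // ltnW.
  by exists j, (i - j)%N; rewrite subn_gt0 subnKC // ltnW.
have period q n : (i <= n)%N -> (x ^+ (n + p * q) = x ^+ n)%g.
  move=> ltin; elim: q => [|q IH]; first by rewrite muln0 addn0.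
  have -> : (n + p * q.+1 = (i + p) + (n - i + p * q))%N by rewrite mulnS; lia.
  by rewrite expgnDr ip -expgnDr addnA subnKC.
exists (p * i.+1).-1; rewrite prednK ?muln_gt0 ?p0 // /idempotent.
by rewrite -expgnDr period // ltnW // leq_pmull.
Qed.

Lemma Ltilde_refl (m : M) : Ltilde m m.
Proof. by apply/LtildeP. Qed.

Lemma Ltilde_sym (m n : M) : Ltilde m n = Ltilde n m.
Proof. by apply/LtildeP/LtildeP=> H f /H[? ?]. Qed.

Lemma Ltilde_trans (m n p : M) : Ltilde m n -> Ltilde n p -> Ltilde m p.
Proof.
move=> /LtildeP H1 /LtildeP H2; apply/LtildeP=> f If.
exact: iff_trans (H1 f If) (H2 f If).
Qed.

Lemma Ltilde_mulr_fix (x : M) : Ltilde E x -> (x * E)%g = x.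
Proof. by move=> /LtildeP/(_ _ (valP e))[+ _]; rewrite idemE; apply. Qed.

Lemma Ltilde_mulr_maxsub (HM : right_fountain M) (x : M) (g : maxsub e) :
  Ltilde E x -> Ltilde E (x * val g)%g.
Proof.
move=> Ex; have xE := Ltilde_mulr_fix Ex.
have /existsP[f /andP[]] := forallP HM (x * val g)%g.
rewrite inE => xgf If; have /eqP ff := If.
apply: (@Ltilde_trans _ f); last by rewrite Ltilde_sym.
have /LtildeP xgfP := xgf; have /LtildeP ExP := Ex.
have fE : (f * E = f)%g.
  by apply/(xgfP _ (valP e)); rewrite -mulgA unit_mulr.
have gV : (val g * val g^-1 = E)%g by rewrite -val_maxsubM mulgV.
have Vg : (val g^-1 * val g = E)%g by rewrite -val_maxsubM mulVg.
pose h : M := (val g * f * val g^-1)%g.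
have xh : (x * h = x)%g.
  have xgf1 : (x * val g * f = x * val g)%g by apply/(xgfP _ If).
  by rewrite /h !mulgA xgf1 -mulgA gV.
have [N hN] := idempotent_pow h.
have xhN n : (x * h ^+ n = x)%g.
  by elim: n => [|n IH]; rewrite ?expg0 ?mulg1 // expgS mulgA xh.
have EhN : (E * h ^+ N.+1 = E)%g by apply/(ExP _ hN).
pose w : M := (val g^-1 * h ^+ N * val g)%g.
have wf : (w * f = E)%g.
  have Vh : (val g^-1 * h ^+ N.+1 = val g^-1)%g.
    by rewrite -[in LHS](unit_mulr (g^-1)%g) -mulgA EhN unit_mulr.
  have gfE : (val g * f = h * val g)%g by rewrite /h -!mulgA Vg fE.
  by rewrite /w -mulgA gfE mulgA -(mulgA _ _ h) -expgSr Vh.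
apply/LtildeP=> d _; split=> Hd; last by rewrite -wf -mulgA Hd.
by rewrite -fE -mulgA Hd.
Qed.

Lemma Ltilde_mulr_maxsubE (HM : right_fountain M) (x : M) (g : maxsub e) :
  (x * E)%g = x -> Ltilde E (x * val g)%g = Ltilde E x.
Proof.
move=> xE; apply/idP/idP=> [|]; last exact: Ltilde_mulr_maxsub.
move/(Ltilde_mulr_maxsub HM (g^-1)%g).
by rewrite -mulgA -val_maxsubM mulgV val_maxsub1 xE.
Qed.

Lemma Ltilde_mull (m x : M) :
  Ltilde E x -> forall n, Ltilde E (n * (m * x))%g -> Ltilde E (m * x)%g.
Proof.
move=> /LtildeP Ex n /LtildeP H; apply/LtildeP=> f If.
by split=> [/(Ex f If)|] xf; [rewrite -mulgA xf | apply/(H f If); rewrite -2!mulgA (mulgA m) xf].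
Qed.

End LtildeMaxsub.
Section Rclass.
Variables (M : finMonoidType) (e : idem M).
Local Notation E := (val e).

Lemma greenRP (m n : M) :
  reflect ((exists x, n = m * x)%g /\ (exists y, m = n * y)%g) (greenR m n).
Proof.
apply: (iffP eqP) => [/setP H|[[x nx] [y my]]].
  split.
    have : n \in [set (n * x)%g | x in [set: M]].
      by apply/imsetP; exists 1%g; rewrite ?inE ?mulg1.
    by rewrite -H => /imsetP[x _ ->]; exists x.
  have : m \in [set (m * x)%g | x in [set: M]].
    by apply/imsetP; exists 1%g; rewrite ?inE ?mulg1.
  by rewrite H => /imsetP[x _ ->]; exists x.
apply/setP=> z; apply/imsetP/imsetP=> -[t _ ->].
  by exists (y * t)%g; rewrite ?inE // mulgA -my.
by exists (x * t)%g; rewrite ?inE // mulgA -nx.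
Qed.

Lemma Rclass_mull (g : maxsub e) (r : M) :
  greenR E r -> greenR E (val g * r)%g.
Proof.
move=> /greenRP[[x ->] [y Ey]]; apply/greenRP; split.
  by exists (val g * x)%g; rewrite !mulgA unit_mulr unit_mull.
exists (y * val g^-1)%g; rewrite !mulgA -(mulgA (val g)) -(mulgA (val g)) -Ey.
by rewrite unit_mulr -val_maxsubM mulgV.
Qed.

Lemma Rclass_idl (r : M) : greenR E r -> (E * r = r)%g.
Proof. by move=> /greenRP[[x ->] _]; rewrite mulgA idemE. Qed.

Lemma Rclass_mullE (g : maxsub e) (r : M) : (E * r = r)%g ->
  greenR E (val g * r)%g = greenR E r.
Proof.
move=> Er; apply/idP/idP=> [|]; last exact: Rclass_mull.
by move/(Rclass_mull (g^-1)%g); rewrite mulgA -val_maxsubM mulVg val_maxsub1 Er.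
Qed.

Lemma Rclass_mulr (r m : M) : greenR E r ->
  forall n, greenR E (r * m * n)%g -> greenR E (r * m)%g.
Proof.
move=> /greenRP[[x rx] _] n /greenRP[_ [y Ey]]; apply/greenRP; split.
  by exists (x * m)%g; rewrite mulgA -rx.
by exists (n * y)%g; rewrite mulgA.
Qed.

End Rclass.

Section VspaceBounds.
Variables (k : fieldType) (V : vectType k).
Implicit Types (U W : {vspace V}) (P : {vspace V} -> Prop).

Lemma vsum_ex P : exists U, (forall W, P W -> (W <= U)%VS) /\
  (forall U', (forall W, P W -> (W <= U')%VS) -> (U <= U')%VS).
Proof.
suff H n U : (\dim {:V} - \dim U <= n)%N ->
    (forall U', (forall W, P W -> (W <= U')%VS) -> (U <= U')%VS) ->
  exists U, (forall W, P W -> (W <= U)%VS) /\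
  (forall U', (forall W, P W -> (W <= U')%VS) -> (U <= U')%VS).
  by apply: (H _ 0%VS (leqnn _)) => U' _; apply: sub0v.
elim: n U => [|n IH] U dU leU.
  exists U; split=> // W _; have : (fullv <= U)%VS; last exact/subv_trans/subvf.
  by rewrite -(dimv_leqif_sup (subvf U)) // eqn_leq dimvS ?subvf // -subn_eq0 -leqn0.
have [ub|/not_all_ex_not[W nW]] := classic (forall W, P W -> (W <= U)%VS).
  by exists U.
have [PW /negP WU] : P W /\ ~ (W <= U)%VS.
  by split; [apply: NNPP => nP | move=> WU]; apply: nW.
apply: (IH (U + W)%VS); last first.
  by move=> U' ub; rewrite subv_add leU //= ub.
have UW : (U <= U + W)%VS by apply: addvSl.
have lt : (\dim U < \dim (U + W))%N.
  rewrite ltn_neqAle dimvS // andbT (dimv_leqif_sup UW).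
  by apply: contra WU => /(subv_trans (addvSr _ _)).
have := dimvS (subvf (U + W)); lia.
Qed.

Lemma vcap_ex P : exists U, forall v, v \in U <-> (forall W, P W -> v \in W).
Proof.
suff H n U : (\dim U <= n)%N ->
    (forall v, (forall W, P W -> v \in W) -> v \in U) ->
  exists U, forall v, v \in U <-> (forall W, P W -> v \in W).
  by apply: (H _ fullv (leqnn _)) => v _; apply: memvf.
elim: n U => [|n IH] U dU geU.
  exists U => v; split=> [|/geU//]; move: dU; rewrite leqn0 dimv_eq0 => /eqP-> + W _.
  by rewrite memv0 => /eqP->; apply: mem0v.
have [lb|/not_all_ex_not[W nW]] := classic (forall W, P W -> (U <= W)%VS).
  exists U => v; split=> [vU W PW|/geU//]; exact: subvP (lb W PW) _ vU.
have [PW /negP UW] : P W /\ ~ (U <= W)%VS.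
  by split; [apply: NNPP => nP | move=> UW]; apply: nW.
apply: (IH (U :&: W)%VS); last first.
  by move=> v vP; rewrite memv_cap geU //= vP.
have UWU : (U :&: W <= U)%VS by apply: capvSl.
have lt : (\dim (U :&: W) < \dim U)%N.
  rewrite ltn_neqAle dimvS // andbT (dimv_leqif_sup UWU).
  by apply: contra UW => /subv_trans; apply; apply: capvSr.
lia.
Qed.

(* Sum, resp. intersection, of a possibly infinite family of subspaces. *)
Definition vsum P : {vspace V} :=
  proj1_sig (constructive_indefinite_description _ (vsum_ex P)).
Definition vcap P : {vspace V} :=
  proj1_sig (constructive_indefinite_description _ (vcap_ex P)).

Lemma vsum_sup P W : P W -> (W <= vsum P)%VS.
Proof.
exact: (proj2_sig (constructive_indefinite_description _ (vsum_ex P))).1.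
Qed.

Lemma vsum_min P U : (forall W, P W -> (W <= U)%VS) -> (vsum P <= U)%VS.
Proof.
exact: (proj2_sig (constructive_indefinite_description _ (vsum_ex P))).2.
Qed.

Lemma mem_vcap P v : v \in vcap P <-> (forall W, P W -> v \in W).
Proof. exact: (proj2_sig (constructive_indefinite_description _ (vcap_ex P))). Qed.

End VspaceBounds.
(* A finite dimensional left module over the monoid algebra kT, presented as a
   finite dimensional k-space with a linear action of the monoid T. *)
Record fdmodule (k : fieldType) (T : finMonoidType) := FdModule {
  fdmod_space :> vectType k;
  fdact : T -> 'End(fdmod_space);
  fdact1 : fdact 1%g = \1%VF;
  fdactM : forall s t, fdact (s * t)%g = (fdact s \o fdact t)%VF
}.

Section Modules.
Variables (k : fieldType) (T : finMonoidType).
Implicit Types (V W A B P S : fdmodule k T).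

Definition is_hom V W (f : 'Hom(V, W)) : Prop :=
  forall t, (f \o fdact V t = fdact W t \o f)%VF.

Definition isomorphic V W : Prop :=
  exists f : 'Hom(V, W), is_hom f /\ bijective f.

Definition is_submodule V (U : {vspace V}) : bool :=
  [forall t, (fdact V t @: U <= U)%VS].

Definition simple_submodule V (U : {vspace V}) : Prop :=
  [/\ is_submodule U, U != 0%VS &
      forall U' : {vspace V}, is_submodule U' -> (U' <= U)%VS ->
        U' = 0%VS \/ U' = U].

Definition simple_module V : Prop := simple_submodule (@fullv k V).

Definition maximal_submodule V (U : {vspace V}) : Prop :=
  [/\ is_submodule U, U != fullv &
      forall U' : {vspace V}, is_submodule U' -> (U <= U')%VS ->
        U' = U \/ U' = fullv].

Definition socle V : {vspace V} := vsum (@simple_submodule V).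

Definition radical V : {vspace V} := vcap (@maximal_submodule V).

Definition indecomposable V : Prop :=
  @fullv k V != 0%VS /\
  forall U W : {vspace V}, is_submodule U -> is_submodule W ->
    (U + W)%VS = fullv -> (U :&: W)%VS = 0%VS -> U = 0%VS \/ W = 0%VS.

Definition projective P : Prop :=
  forall A B (p : 'Hom(A, B)) (f : 'Hom(P, B)),
    is_hom p -> limg p = fullv -> is_hom f ->
    exists h : 'Hom(P, A), is_hom h /\ (p \o h)%VF = f.

Lemma submoduleP V (U : {vspace V}) :
  reflect (forall t u, u \in U -> fdact V t u \in U) (is_submodule U).
Proof.
apply: (iffP forallP) => H t; first by move=> u uU; apply/(subvP (H t))/memv_img.
by apply/subvP=> _ /memv_imgP[u uU ->]; apply: H.
Qed.

Section Sub.
Variables (V : fdmodule k T) (U : {vspace V}) (HU : is_submodule U).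

Definition sub_act t : 'End(subvs_of U) :=
  (linfun (vsproj U) \o fdact V t \o linfun vsval)%VF.

Lemma val_sub_act t u : vsval (sub_act t u) = fdact V t (vsval u).
Proof.
rewrite /sub_act !lfunE /= !lfunE /= !lfunE /= vsprojK //.
exact/(submoduleP _ HU)/subvsP.
Qed.

Fact sub_act1 : sub_act 1%g = \1%VF.
Proof. by apply/lfunP=> u; apply: subvs_inj; rewrite val_sub_act fdact1 !lfunE. Qed.

Fact sub_actM s t : sub_act (s * t)%g = (sub_act s \o sub_act t)%VF.
Proof.
apply/lfunP=> u; apply: subvs_inj.
by rewrite val_sub_act fdactM lfunE /= lfunE /= !val_sub_act.
Qed.

Definition submodule_module : fdmodule k T := FdModule sub_act1 sub_actM.

End Sub.

(* The quotient V/U is carried by the complement U^C of U in V; [quot_proj] is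
   the canonical projection onto it, with kernel U. *)
Section Quotient.
Variables (V : fdmodule k T) (U : {vspace V}) (HU : is_submodule U).

Definition quot_proj : 'Hom(V, subvs_of U^C) :=
  (linfun (vsproj U^C) \o (\1 - projv U))%VF.

Definition quot_act t : 'End(subvs_of U^C) :=
  (quot_proj \o fdact V t \o linfun vsval)%VF.

Lemma val_quot_proj v : vsval (quot_proj v) = v - projv U v.
Proof.
by rewrite comp_lfunE lfunE /= add_lfunE opp_lfunE id_lfunE vsprojK ?memv_projC.
Qed.

Lemma quot_proj_eq0 v : (quot_proj v == 0) = (v \in U).
Proof.
rewrite -(inj_eq (@subvs_inj _ _ _)) val_quot_proj linear0 subr_eq0.
by apply/eqP/idP=> [->|/projv_id->]; rewrite ?memv_proj.
Qed.

Lemma quot_projK u : quot_proj (vsval u) = u.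
Proof.
apply: subvs_inj; rewrite val_quot_proj.
suff -> : projv U (vsval u) = 0 by rewrite subr0.
have : projv U (vsval u) \in (U :&: U^C)%VS.
  rewrite memv_cap memv_proj -[X in X \in _](subKr (vsval u)).
  by rewrite memvB ?subvsP ?memv_projC.
by rewrite capv_compl memv0 => /eqP.
Qed.

Lemma quot_proj_hom t v : quot_proj (fdact V t v) = quot_act t (quot_proj v).
Proof.
have -> : quot_act t (quot_proj v) = quot_proj (fdact V t (vsval (quot_proj v))).
  by rewrite [LHS]comp_lfunE [linfun vsval _]lfunE [LHS]comp_lfunE.
apply/eqP; rewrite -subr_eq0 -!raddfB /=.
rewrite quot_proj_eq0; apply/(submoduleP _ HU).
by rewrite -quot_proj_eq0 raddfB /= quot_projK subrr.
Qed.

Fact quot_act1 : quot_act 1%g = \1%VF.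
Proof.
by apply/lfunP=> u; rewrite -[u]quot_projK -quot_proj_hom fdact1 !lfunE.
Qed.

Fact quot_actM s t : quot_act (s * t)%g = (quot_act s \o quot_act t)%VF.
Proof.
apply/lfunP=> u; rewrite -[u]quot_projK [RHS]comp_lfunE -!quot_proj_hom fdactM.
by rewrite [in LHS]comp_lfunE.
Qed.

Definition quotient_module : fdmodule k T := FdModule quot_act1 quot_actM.

End Quotient.

Fact socle_submodule V : is_submodule (socle V).
Proof.
apply/submoduleP=> t u; rewrite (memv_preim (fdact V t)).
move: u; apply/subvP/vsum_min => W sW; apply/subvP=> u uW.
have [/submoduleP WW _ _] := sW.
by rewrite -memv_preim; apply: (subvP (vsum_sup sW)); apply: WW.
Qed.

Fact radical_submodule V : is_submodule (radical V).
Proof.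
apply/submoduleP=> t u /mem_vcap Hu; apply/mem_vcap=> W mW.
by have [/submoduleP WW _ _] := mW; apply/WW/Hu.
Qed.

Definition socle_module V := submodule_module (socle_submodule V).
Definition head_module V := quotient_module (radical_submodule V).

Definition is_projective_cover P S : Prop :=
  [/\ projective P, indecomposable P & isomorphic (head_module P) S].

End Modules.

(* {ffun I -> W} is the direct sum of copies of W indexed by I, that is kI (x) W;
   [pure i w] is i (x) w. A partial map f : I -> option J induces the linear map
   sending i (x) w to j (x) w if f i = Some j and to 0 if f i = None. *)
Section Push.
Variables (k : fieldType) (W : vectType k).

Definition pure (I : finType) (i : I) (w : W) : {ffun I -> W} :=
  [ffun j => if j == i then w else 0].

Definition push_fun (I J : finType) (f : I -> option J) (F : {ffun I -> W}) :
  {ffun J -> W} := [ffun j => \sum_(i | f i == Some j) F i].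

Fact push_linear (I J : finType) (f : I -> option J) : linear (push_fun f).
Proof.
move=> a F G; apply/ffunP=> j; rewrite !ffunE scaler_sumr -big_split /=.
by apply: eq_bigr => i _; rewrite !ffunE.
Qed.

HB.instance Definition _ (I J : finType) (f : I -> option J) :=
  GRing.isLinear.Build k {ffun I -> W} {ffun J -> W} *:%R (push_fun f)
    (push_linear f).

Definition push (I J : finType) (f : I -> option J) :
  'Hom({ffun I -> W}, {ffun J -> W}) := linfun (push_fun f).

Lemma ffun_pureE (I : finType) (F : {ffun I -> W}) : F = \sum_i pure i (F i).
Proof.
apply/ffunP=> j; rewrite sum_ffunE (bigD1 j) //= ffunE eqxx big1 ?addr0 // => i ij.
by rewrite ffunE eq_sym (negPf ij).
Qed.

Lemma push_pure (I J : finType) (f : I -> option J) i w :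
  push f (pure i w) = if f i is Some j then pure j w else 0.
Proof.
rewrite lfunE; apply/ffunP=> j; rewrite ffunE.
rewrite (eq_bigr (fun i' => if i' == i then w else 0)); last first.
  by move=> i' _; rewrite ffunE.
rewrite -big_mkcondr /=.
rewrite (eq_bigl (fun i' => (i' == i) && (f i == Some j))); last first.
  by move=> i'; rewrite andbC; case: eqP => // ->.
rewrite big_mkcondr big_pred1_eq; case: (f i) => [j'|]; rewrite ffunE //.
by rewrite (inj_eq Some_inj) eq_sym.
Qed.

Lemma lfun_pureP (I : finType) (U : vectType k) (f g : 'Hom({ffun I -> W}, U)) :
  (forall i w, f (pure i w) = g (pure i w)) -> f = g.
Proof.
move=> H; apply/lfunP=> F; rewrite [F]ffun_pureE !linear_sum /=.
by apply: eq_bigr => i _; apply: H.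
Qed.

End Push.

Section InducedCoinduced.
Variables (k : fieldType) (M : finMonoidType) (e : idem M).
Local Notation E := (val e).

Definition Lt_type := {x : M | x \in Ltclass E}.
Definition Rc_type := {r : M | r \in Rclass E}.
HB.instance Definition _ := SubFinite.on Lt_type.
HB.instance Definition _ := SubFinite.on Rc_type.

(* The left action of M on kL~_e, extended to kL~_e (x)_k W. *)
Section LtModule.
Variable W : vectType k.

Definition Lt_act (m : M) : 'End({ffun Lt_type -> W}) :=
  push W (fun x : Lt_type => insub (m * val x)%g : option Lt_type).

Fact Lt_act1 : Lt_act 1%g = \1%VF.
Proof.
apply: lfun_pureP => x w; rewrite push_pure mul1g.
by rewrite (valK x) id_lfunE.
Qed.

Fact Lt_actM s t : Lt_act (s * t)%g = (Lt_act s \o Lt_act t)%VF.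
Proof.
apply: lfun_pureP => x w; rewrite comp_lfunE !push_pure.
case: (insubP _ (t * val x)%g) => [y yL ty|ntx].
  by rewrite push_pure ty mulgA.
rewrite linear0; case: insubP => // y; rewrite -mulgA !inE => sL _.
case/negP: ntx; rewrite inE; apply: Ltilde_mull sL.
by have := valP x; rewrite inE.
Qed.

Definition Lt_module : fdmodule k M := FdModule Lt_act1 Lt_actM.

End LtModule.

Section Tensor.
Variables (HM : right_fountain M) (V : fdmodule k (maxsub e)).

(* The lines spanned by x g (x) v - x (x) g v, for x in L~_e, g in G_e, v in V;
   x g always lies in L~_e by Ltilde_mulr_maxsub. *)
Definition balanced_relation (U : {vspace Lt_module V}) : Prop :=
  exists (x y : Lt_type) (g : maxsub e) (v : V),
    val y = (val x * val g)%g /\ U = <[pure y v - pure x (fdact V g v)]>%VS.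

Definition balanced_relations : {vspace Lt_module V} := vsum balanced_relation.

Fact balanced_relations_submodule : is_submodule balanced_relations.
Proof.
apply/submoduleP=> t u; rewrite (memv_preim (fdact (Lt_module V) t)).
move: u; apply/subvP/vsum_min => W [x [y [g [v [yE ->]]]]].
rewrite -memvE -memv_preim linearB /= !push_pure yE mulgA.
have xL : Ltilde E (val x) by have := valP x; rewrite inE.
have HE : Ltilde E (t * val x * val g)%g = Ltilde E (t * val x)%g.
  by apply: Ltilde_mulr_maxsubE; rewrite // -mulgA Ltilde_mulr_fix.
case: insubP => [y'|]; rewrite inE HE => tx.
  move=> y'E; rewrite insubT ?inE // => tx'.
  suff /vsum_sup : balanced_relation
    <[pure y' v - pure (Sub (t * val x)%g tx' : Lt_type) (fdact V g v)]>%VS.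
    by rewrite -memvE.
  by exists (Sub (t * val x)%g tx'), y', g, v; split=> //; rewrite y'E SubK.
by rewrite insubF ?subrr ?mem0v // inE; apply: negbTE.
Qed.

(* kL~_e (x)_{kG_e} V *)
Definition tensor_module : fdmodule k M :=
  quotient_module balanced_relations_submodule.

End Tensor.

Definition kR : vectType k := {ffun Rc_type -> k^o}.

Definition kR_lact (g : maxsub e) : 'End(kR) :=
  push k^o (fun r : Rc_type => insub (val g * val r)%g : option Rc_type).

Definition kR_ract (m : M) : 'End(kR) :=
  push k^o (fun r : Rc_type => insub (val r * m)%g : option Rc_type).

Lemma kR_ract1 : kR_ract 1%g = \1%VF.
Proof.
by apply: lfun_pureP => r w; rewrite push_pure mulg1 (valK r) id_lfunE.
Qed.

Lemma kR_ractM s t : kR_ract (s * t)%g = (kR_ract t \o kR_ract s)%VF.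
Proof.
apply: lfun_pureP => r w; rewrite comp_lfunE !push_pure.
case: (insubP _ (val r * s)%g) => [y yR ry|nrs].
  by rewrite push_pure ry mulgA.
rewrite linear0; case: insubP => // y; rewrite mulgA !inE => sR _.
case/negP: nrs; rewrite inE; apply: Rclass_mulr sR.
by have := valP r; rewrite inE.
Qed.

Lemma kR_bimodule g m : (kR_ract m \o kR_lact g = kR_lact g \o kR_ract m)%VF.
Proof.
apply: lfun_pureP => r w; rewrite !comp_lfunE !push_pure.
have rR : greenR E (val r) by have := valP r; rewrite inE.
case: insubP => [y yR gr|]; last by rewrite inE Rclass_mull.
rewrite push_pure gr; case: insubP => [z|]; rewrite inE.
  rewrite -mulgA Rclass_mullE ?mulgA ?Rclass_idl // => rm zE.
  rewrite (insubT (fun x => x \in Rclass E)) ?inE // => rm'.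
  rewrite push_pure; case: insubP => [z' _ z'E|]; last first.
    by rewrite inE SubK Rclass_mull.
  by congr pure; apply: val_inj; rewrite /= z'E zE SubK mulgA.
rewrite -mulgA Rclass_mullE ?mulgA ?Rclass_idl // => rm.
by rewrite insubF ?linear0 // inE; apply: negbTE.
Qed.

Section Coind.
Variable V : fdmodule k (maxsub e).

(* Hom_k(kR_e, V) as a left kM-module, and inside it Hom_{kG_e}(kR_e, V). *)
Definition hom_act_fun (m : M) (phi : 'Hom(kR, V)) : 'Hom(kR, V) :=
  (phi \o kR_ract m)%VF.

Fact hom_act_linear m : linear (hom_act_fun m).
Proof.
by move=> a phi psi; apply/lfunP=> r; rewrite !(comp_lfunE, add_lfunE, scale_lfunE).
Qed.

HB.instance Definition _ m :=
  GRing.isLinear.Build k 'Hom(kR, V) 'Hom(kR, V) *:%R (hom_act_fun m)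
    (hom_act_linear m).

Definition hom_act (m : M) : 'End('Hom(kR, V)) := linfun (hom_act_fun m).

Fact hom_act1 : hom_act 1%g = \1%VF.
Proof.
by apply/lfunP=> phi; rewrite lfunE id_lfunE /= /hom_act_fun kR_ract1 comp_lfun1r.
Qed.

Fact hom_actM s t : hom_act (s * t)%g = (hom_act s \o hom_act t)%VF.
Proof.
apply/lfunP=> phi; rewrite comp_lfunE !lfunE /= /hom_act_fun.
by rewrite kR_ractM comp_lfunA.
Qed.

Definition hom_module : fdmodule k M := FdModule hom_act1 hom_actM.

Definition commutator_fun (g : maxsub e) (phi : 'Hom(kR, V)) : 'Hom(kR, V) :=
  ((phi \o kR_lact g) - (fdact V g \o phi))%VF.

Fact commutator_linear g : linear (commutator_fun g).
Proof.
move=> a phi psi; rewrite /commutator_fun comp_lfunDl comp_lfunDr.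
by rewrite -comp_lfunZl -comp_lfunZr scalerBr opprD addrACA.
Qed.

HB.instance Definition _ g :=
  GRing.isLinear.Build k 'Hom(kR, V) 'Hom(kR, V) *:%R (commutator_fun g)
    (commutator_linear g).

Definition hom_G : {vspace hom_module} :=
  (\bigcap_(g : maxsub e) lker (linfun (commutator_fun g)))%VS.

Lemma mem_hom_G (phi : 'Hom(kR, V)) :
  phi \in hom_G <-> forall g, (phi \o kR_lact g = fdact V g \o phi)%VF.
Proof.
have -> : (phi \in hom_G) = [forall g, phi \in lker (linfun (commutator_fun g))].
  by rewrite memvE; apply/subv_bigcapP/forallP=> H g; have := H g;
    rewrite ?memvE //; apply.
split=> [/forallP H g|H]; last apply/forallP=> g.
  by have := H g; rewrite memv_ker lfunE /= subr_eq0 => /eqP.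
by rewrite memv_ker lfunE /= subr_eq0; apply/eqP.
Qed.

Fact hom_G_submodule : is_submodule hom_G.
Proof.
apply/submoduleP=> t phi /mem_hom_G phiG; apply/mem_hom_G=> g.
rewrite /= lfunE /= /hom_act_fun -comp_lfunA kR_bimodule comp_lfunA phiG.
by rewrite -comp_lfunA.
Qed.

(* Hom_{kG_e}(kR_e, V), with (m phi)(r) = phi(r m) *)
Definition Coind : fdmodule k M := submodule_module hom_G_submodule.

(* V^# *)
Definition sharp : fdmodule k M := socle_module Coind.

End Coind.

End InducedCoinduced.

(* The algebra kT of a finite monoid T: functions T -> k under convolution. *)
Definition malg (k : fieldType) (T : finMonoidType) := {ffun T -> k}.

Section MonoidAlgebra.
Variables (k : fieldType) (T : finMonoidType).
Implicit Types a b c : malg k T.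

HB.instance Definition _ := GRing.Zmodule.on (malg k T).

Definition malg_of (t : T) : malg k T := [ffun s => (s == t)%:R].

Definition malg_mul a b : malg k T :=
  [ffun t => \sum_x \sum_(y | (x * y)%g == t) a x * b y].

Definition malg_one : malg k T := malg_of 1%g.

Lemma sum_fiber (f : T -> T) (P : pred T) (F : T -> k) :
  \sum_(u | P u) \sum_(z | f z == u) F z = \sum_(z | P (f z)) F z.
Proof.
rewrite [RHS](partition_big f P) //; apply: eq_bigr => u Pu.
by apply: eq_bigl => z; case: eqP => [->|]; rewrite ?Pu ?andbF.
Qed.

Fact malg_mulA : associative malg_mul.
Proof.
move=> a b c; apply/ffunP=> t; rewrite !ffunE.
transitivity (\sum_x \sum_y \sum_(z | (x * (y * z))%g == t) a x * (b y * c z)).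
  apply: eq_bigr => x _.
  under eq_bigr => u _ do rewrite ffunE mulr_sumr.
  rewrite exchange_big /=; apply: eq_bigr => y _.
  rewrite -(sum_fiber (fun z => (y * z)%g) (fun u => (x * u)%g == t)).
  by apply: eq_bigr => u _; rewrite mulr_sumr.
symmetry; rewrite (exchange_big_dep xpredT) //=.
transitivity (\sum_z \sum_x \sum_(y | (x * y * z)%g == t) a x * b y * c z).
  apply: eq_bigr => z _.
  under eq_bigr => u _ do rewrite ffunE mulr_suml.
  rewrite exchange_big /=; apply: eq_bigr => x _.
  rewrite -(sum_fiber (fun y => (x * y)%g) (fun u => (u * z)%g == t)).
  by apply: eq_bigr => u _; rewrite mulr_suml.
rewrite exchange_big /=; apply: eq_bigr => x _.
rewrite (exchange_big_dep xpredT) //=; apply: eq_bigr => y _.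
by apply: eq_big => [z|z _]; rewrite ?mulgA ?mulrA.
Qed.

Fact malg_mul1 : left_id malg_one malg_mul.
Proof.
move=> a; apply/ffunP=> t; rewrite ffunE (bigD1 1%g) //= [X in _ + X]big1.
  rewrite addr0 (big_pred1 t) => [|y]; last by rewrite mul1g.
  by rewrite ffunE eqxx mul1r.
by move=> x x1; rewrite big1 // => y _; rewrite ffunE (negPf x1) mul0r.
Qed.

Fact malg_mulr1 : right_id malg_one malg_mul.
Proof.
move=> a; apply/ffunP=> t; rewrite ffunE.
rewrite (exchange_big_dep xpredT) //= (bigD1 1%g) //= [X in _ + X]big1.
  rewrite addr0 (big_pred1 t) => [|y]; last by rewrite mulg1.
  by rewrite ffunE eqxx mulr1.
by move=> x x1; rewrite big1 // => y _; rewrite ffunE (negPf x1) mulr0.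
Qed.

Fact malg_mulDl : left_distributive malg_mul +%R.
Proof.
move=> a b c; apply/ffunP=> t; rewrite !ffunE -big_split; apply: eq_bigr => x _.
by rewrite -big_split; apply: eq_bigr => y _; rewrite !ffunE mulrDl.
Qed.

Fact malg_mulDr : right_distributive malg_mul +%R.
Proof.
move=> a b c; apply/ffunP=> t; rewrite !ffunE -big_split; apply: eq_bigr => x _.
by rewrite -big_split; apply: eq_bigr => y _; rewrite !ffunE mulrDr.
Qed.

Fact malg_one_neq0 : malg_one != 0.
Proof.
apply/eqP=> /ffunP/(_ 1%g); rewrite !ffunE eqxx => /eqP.
by rewrite oner_eq0.
Qed.

HB.instance Definition _ := GRing.Zmodule_isNzRing.Build (malg k T)
  malg_mulA malg_mul1 malg_mulr1 malg_mulDl malg_mulDr malg_one_neq0.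

End MonoidAlgebra.

Section Sandwich.
Variables (k : fieldType) (M : finMonoidType) (e : idem M).
Local Notation E := (val e).

Definition Rclasses (J : {set M}) : {set {set M}} := [set Rclass m | m in J].
Definition Lclasses (J : {set M}) : {set {set M}} := [set Lclass m | m in J].

Definition Rclass_reps (rho : {set M} -> M) : Prop :=
  forall a, a \in Rclasses (Jclass E) -> rho a \in Lclass E :&: a.

Definition Lclass_reps (lam : {set M} -> M) : Prop :=
  forall b, b \in Lclasses (Jclass E) -> lam b \in Rclass E :&: b.

Definition sandwich (rho lam : {set M} -> M) :
  'M[malg k (maxsub e)]_(#|Lclasses (Jclass E)|, #|Rclasses (Jclass E)|) :=
  \matrix_(b, a)
    if (insub (lam (enum_val b) * rho (enum_val a))%g : option (maxsub e))
    is Some g then malg_of k g else 0.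

End Sandwich.

Definition right_invertible (R : nzRingType) (p q : nat) (A : 'M[R]_(p, q)) : Prop :=
  exists B : 'M[R]_(q, p), A *m B = 1%:M.

Definition regularJ_representatives (M : finMonoidType) (n : nat)
    (e : 'I_n -> idem M) : Prop :=
  forall m : M, regularJ m -> exists! i, val (e i) \in Jclass m.

(* Main.v *)
Require Import Defs.
From HB Require Import structures.
From mathcomp Require Import all_boot all_order all_fingroup all_algebra.
From Stdlib Require Import Classical ClassicalEpsilon.

Set Implicit Arguments.
Unset Strict Implicit.
Unset Printing Implicit Defensive.

Import GRing.Theory.

Local Open Scope ring_scope.

(** The three conditions are compared through one notion. Call [f] below [e] if
    [f] is an idempotent with [e f = f e = f] and [f <> e], and call a vector [x]
    of a [kM]-module singular for [e] if [e x = x] and [f x = 0] for all [f] below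
    [e] (compare highest weight vectors). The group [G_e] acts on the singular
    vectors for [e]. The three families of modules are governed by them:

    - [T = kL~_e (x) V] is the universal module with an equivariant map from [V]
      to its singular vectors ([tensor_lift]). This is where the Fountain
      condition enters: if [m x] leaves [L~_e] for some [x] in [L~_e], then
      [m x = m x f] for some [f] below [e].
    - In [Coind_g V] there is no nonzero singular vector for [e] unless [e J g]
      ([singular_coind_greenJ]), and for [g = e] the singular vectors are a copy
      [coind_unit] of [V]. Every nonzero submodule meets this copy, because
      [r s = coind_unit (s r)] for [r] in [R_e] ([act_coind]). Hence, for simple
      [V], the module [Coind V] is simple iff the copy of [V] generates it.
    - If [S] is a simple module and [e] is [J]-minimal among the idempotents
      acting nontrivially on [S], then [e S] is a simple [G_e]-module consisting
      of singular vectors, and [S] embeds in [Coind (e S)]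
      ([simple_module_apex]).

    (2) implies (3). Singular vectors lift along surjections whose kernel is a
    coinduced module, whatever the module ([singular_lift_coind]): the correcting
    function in [Coind] can be written down. Under (2) every simple module is
    coinduced, so singular vectors lift along all surjections ([singular_lift]),
    and averaging over [G_e] makes the lifts of a copy of [V] equivariant, which
    is projectivity of [T]. Every map from [T] to some [Coind W] with [W] over
    one of the [G_{e_j}] vanishes or has [W] over [G_e] and then factors through
    the canonical map [tensor_coind : T -> Coind V]; since the simple quotients
    of [T] embed in such [Coind W], the kernel of [tensor_coind] is the only
    maximal submodule of [T], which gives the head and indecomposability.

    (3) implies (2). If the copy of [V] generates a proper submodule of [Coind V],
    this lies in a maximal submodule [U]. The simple quotient [Coind V / U]
    receives a nonzero map from some [T], which lifts to [Coind V] by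
    projectivity. But maps from [T] to [Coind V] have their image in the
    submodule generated by the copy of [V], a contradiction.

    (1) and (2). The value at [lambda_b] of [rho_a coind_unit(v)] is [P(b,a) v]
    ([cev_rho_coind_unit]), so a right inverse [Q] of [P] writes an arbitrary
    element of [Coind V] in terms of the copy of [V]. Conversely (2) implies that
    the copy of [V] generates [Coind V] for every [V], by semisimplicity of
    [kG_e] ([coind_span]); for [V = kG_e] the coefficients that express the
    coordinate functions of [Coind (kG_e)] are the columns of a right inverse. *)

(* Not the [idempotent] of ssrfun. *)
Local Notation idempotent := Defs.idempotent.
Local Notation "m |> x" := (fdact _ m x) (at level 40, left associativity).

(** * Green's relations around an idempotent *)

Section Green.
Variable M : finMonoidType.
Implicit Types (e : idem M) (m n r x y f : M).

Lemma greenLP m n :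
  reflect ((exists x, n = x * m)%g /\ (exists y, m = y * n)%g) (greenL m n).
Proof.
apply: (iffP eqP) => [/setP H|[[x nx] [y my]]].
  split.
    have : n \in [set (x * n)%g | x in [set: M]].
      by apply/imsetP; exists 1%g; rewrite ?inE ?mul1g.
    by rewrite -H => /imsetP[x _ ->]; exists x.
  have : m \in [set (x * m)%g | x in [set: M]].
    by apply/imsetP; exists 1%g; rewrite ?inE ?mul1g.
  by rewrite H => /imsetP[x _ ->]; exists x.
apply/setP=> z; apply/imsetP/imsetP=> -[t _ ->].
  by exists (t * y)%g; rewrite ?inE // -mulgA -my.
by exists (t * x)%g; rewrite ?inE // -mulgA -nx.
Qed.

Definition two_sided m : {set M} :=
  [set (x * m * y)%g | x in [set: M], y in [set: M]].

Lemma two_sidedP m n :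
  reflect (exists x y, n = x * m * y)%g (n \in two_sided m).
Proof.
apply: (iffP imset2P) => [[x y _ _ ->]|[x [y ->]]]; first by exists x, y.
by exists x y.
Qed.

Lemma two_sided_refl m : m \in two_sided m.
Proof. by apply/two_sidedP; exists 1%g, 1%g; rewrite mul1g mulg1. Qed.

Lemma two_sided_sub m n : (two_sided n \subset two_sided m) = (n \in two_sided m).
Proof.
apply/idP/idP=> [/subsetP sub|/two_sidedP[x [y ->]]]; first exact/sub/two_sided_refl.
apply/subsetP=> _ /two_sidedP[z [t ->]]; apply/two_sidedP.
by exists (z * x)%g, (y * t)%g; rewrite !mulgA.
Qed.

Lemma greenJP m n :
  reflect (n \in two_sided m /\ m \in two_sided n) (greenJ m n).
Proof.
rewrite /greenJ -/(two_sided m) -/(two_sided n) eqEsubset !two_sided_sub andbC.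
exact: andP.
Qed.

Lemma greenJ_refl m : greenJ m m.
Proof. exact: eqxx. Qed.

Lemma greenJ_sym m n : greenJ m n = greenJ n m.
Proof. exact: eq_sym. Qed.

Lemma greenJ_trans m n p : greenJ m n -> greenJ n p -> greenJ m p.
Proof. by move=> /eqP H1 /eqP H2; apply/eqP; rewrite H1. Qed.

(** Stability of a finite monoid: from [m = x (m y) z] one gets
    [m = x^n m (y z)^n] for every [n], and [(y z)^n] is idempotent for a
    suitable positive [n], so that [m (y z)^n = m]. *)
Lemma stable_right m y : m \in two_sided (m * y)%g -> greenR m (m * y)%g.
Proof.
case/two_sidedP=> x [z mE]; apply/greenRP; split; first by exists y.
have [n /eqP nI] := idempotent_pow (y * z)%g.
have it p : m = (x ^+ p * m * (y * z) ^+ p)%g.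
  elim: p => [|p IH]; first by rewrite !expg0 mul1g mulg1.
  by rewrite [LHS]IH {1}mE expgSr expgS !mulgA.
have mI : m = (m * (y * z) ^+ n.+1)%g.
  by rewrite [in RHS](it n.+1) -[in RHS]mulgA nI -it.
by exists (z * (y * z) ^+ n)%g; rewrite !mulgA -(mulgA m) -mulgA -expgS.
Qed.

Lemma stable_left m y : m \in two_sided (y * m)%g -> greenL m (y * m)%g.
Proof.
case/two_sidedP=> x [z mE]; apply/greenLP; split; first by exists y.
have [n /eqP nI] := idempotent_pow (x * y)%g.
have it p : m = ((x * y) ^+ p * m * z ^+ p)%g.
  elim: p => [|p IH]; first by rewrite !expg0 mul1g mulg1.
  by rewrite [LHS]IH {1}mE expgSr expgS !mulgA.
have mI : m = ((x * y) ^+ n.+1 * m)%g.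
  by rewrite [in RHS](it n.+1) !mulgA nI -it.
by exists ((x * y) ^+ n * x)%g; rewrite !mulgA -(mulgA _ x) -expgSr.
Qed.

(** In a finite monoid [e M e], one-sided invertible elements are invertible. *)
Lemma units_atP e x :
  reflect ((x * val e)%g = x /\ greenR (val e) x) (x \in units_at (val e)).
Proof.
apply: (iffP idP) => [xU|[xE xR]].
  have /unitsP[x1 [y [_ xy yx]]] := xU.
  have Ex : (val e * x = x)%g by rewrite -x1 !mulgA idemE.
  split; first by rewrite -x1 -!mulgA idemE.
  by apply/greenRP; split; [exists x | exists y].
have Ex := Rclass_idl xR; have /greenRP[_ [y yE]] := xR.
have [n /eqP nI] := idempotent_pow x.
have xyn p : (x ^+ p.+1 * y ^+ p.+1 = val e)%g.
  elim: p => [|p IH]; first by rewrite !expg1.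
  have xEp : (x ^+ p.+1 * val e = x ^+ p.+1)%g by rewrite expgSr -mulgA xE.
  by rewrite expgSr (expgS y p.+1) -mulgA (mulgA x) -yE mulgA xEp.
have xn : (x ^+ n.+1 = val e)%g.
  have <- : (x ^+ n.+1 * val e = x ^+ n.+1)%g by rewrite expgSr -mulgA xE.
  by rewrite -[in LHS](xyn n) mulgA nI xyn.
apply/unitsP; split; first by rewrite Ex xE.
exists (val e * x ^+ n * val e)%g; split.
- by rewrite !mulgA idemE -(mulgA _ (val e) (val e)) idemE.
- by rewrite !mulgA xE -expgS xn idemE.
- by rewrite -(mulgA _ (val e)) Ex -(mulgA (val e)) -expgSr xn idemE.
Qed.

Lemma idemR e : greenR (val e) (val e).
Proof. by apply/greenRP; split; exists 1%g; rewrite mulg1. Qed.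

(** The idempotents strictly below [e] in the natural partial order. *)
Definition below e : {set M} :=
  [set f : M | [&& idempotent f, (val e * f)%g == f, (f * val e)%g == f & f != val e]].

Lemma belowP e f :
  reflect [/\ f * f = f, val e * f = f, f * val e = f & f <> val e]%g (f \in below e).
Proof.
rewrite inE; apply: (iffP and4P) => [[/eqP ? /eqP ? /eqP ? /eqP ?]|[? ? ? ?]] //.
by split; apply/eqP.
Qed.

Lemma below_conj e (g : maxsub e) f :
  f \in below e -> (val g^-1 * f * val g)%g \in below e.
Proof.
case/belowP=> ff ef fe fNe; apply/belowP.
have gV : (val g * val g^-1 = val e)%g by rewrite -val_maxsubM mulgV.
split.
- by rewrite !mulgA -(mulgA _ (val g)) gV -(mulgA _ f (val e)) fe -(mulgA _ f f) ff.
- by rewrite !mulgA unit_mull.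
- by rewrite -mulgA unit_mulr.
- move=> H; apply: fNe.
  have <- : (val g * (val g^-1 * f * val g) * val g^-1 = f)%g.
    by rewrite !mulgA gV ef -mulgA gV fe.
  by rewrite H unit_mulr.
Qed.

(** If [r e y = g], then [e y r e] is an idempotent fixed by [e] on both sides
    that acts as a right identity on [r e]: it is below [e] or equal to [e]. *)
Lemma below_split e (g : idem M) r : greenR (val g) (r * val e)%g ->
  (exists2 f, f \in below e & (r * val e * f = r * val e)%g)
  \/ val e \in two_sided (val g).
Proof.
move=> reR; have /greenRP[[x xE] [y yE]] := reR; have gre := Rclass_idl reR.
pose f := (val e * y * (r * val e))%g.
have fE : (r * val e * f = r * val e)%g.
  by rewrite /f !mulgA -(mulgA r) idemE -yE -(mulgA (val g)).
have [fe|fNe] := eqVneq f (val e); [right | left].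
  by apply/two_sidedP; exists (val e * y)%g, x; rewrite -{1}fe /f xE !mulgA.
exists f => //; apply/belowP; split; last exact/eqP.
- by rewrite {1}/f -mulgA fE.
- by rewrite /f !mulgA idemE.
- by rewrite /f -!mulgA idemE.
Qed.

(** An idempotent [f] in the [L~]-class of [x] satisfies [f e = f], and [e f] is
    the idempotent required: it is not [e], for otherwise [e] and [f] would be
    [L]-equivalent. *)
Lemma Ltilde_below e x : right_fountain M ->
  (x * val e)%g = x -> ~~ Ltilde (val e) x ->
  exists2 f, f \in below e & (x * f)%g = x.
Proof.
move=> /forallP/(_ x)/existsP[f /andP[]]; rewrite inE => /LtildeP xf fI xe Nex.
have ff := eqP fI; have fe : (f * val e = f)%g by apply/(xf _ (valP e)).
have xfE : (x * f = x)%g by apply/(xf _ fI).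
exists (val e * f)%g; last by rewrite mulgA xe.
apply/belowP; split.
- by rewrite !mulgA -(mulgA _ f) fe -mulgA ff.
- by rewrite !mulgA idemE.
- by rewrite -mulgA fe.
move=> ef; case/negP: Nex; apply/LtildeP=> h hI; split.
  by move=> eh; apply/(xf _ hI); rewrite -fe -mulgA eh.
by move/(xf _ hI) => fh; rewrite -ef -mulgA fh.
Qed.

Lemma below_NLtilde e f : f \in below e -> ~~ Ltilde (val e) f.
Proof.
case/belowP=> ff ef fe fNe; apply/negP=> /LtildeP/(_ f).
by rewrite /idempotent ff eqxx ef => /(_ isT)[_ /(_ erefl)].
Qed.

End Green.

(** * Submodules, quotients and simple modules *)

(** Lets linear maps be introduced by a formula inside a proof, without
    declaring a canonical linear structure. *)
Lemma linear_lfun (k : fieldType) (U V : vectType k) (f : U -> V) :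
  linear f -> exists F : 'Hom(U, V), forall u, F u = f u.
Proof.
move=> fL; pose fl : {linear U -> V} :=
  HB.pack f (GRing.isLinear.Build k U V *:%R f fL).
by exists (linfun fl) => u; rewrite lfunE.
Qed.

Lemma lfun_neq0 (k : fieldType) (U V : vectType k) (f : 'Hom(U, V)) :
  f != 0 -> exists u, f u != 0.
Proof.
move=> /eqP f0; apply: NNPP => nex; apply: f0; apply/lfunP=> u; rewrite lfunE /=.
by apply/eqP/negPn/negP=> fu; apply: nex; exists u.
Qed.

Section Modules.
Variables (k : fieldType) (T : finMonoidType).
Implicit Types (V W X S : fdmodule k T) (t : T).

Lemma fdact1E V (v : V) : 1%g |> v = v.
Proof. by rewrite fdact1 id_lfunE. Qed.

Lemma fdactME V s t (v : V) : (s * t)%g |> v = s |> (t |> v).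
Proof. by rewrite fdactM comp_lfunE. Qed.

Lemma homP V W (f : 'Hom(V, W)) :
  is_hom f <-> forall t v, f (t |> v) = t |> f v.
Proof.
split=> [fh t v|fh t]; first by have /lfunP/(_ v) := fh t; rewrite !comp_lfunE.
by apply/lfunP=> v; rewrite !comp_lfunE.
Qed.

Lemma hom_comp V W X (f : 'Hom(V, W)) (g : 'Hom(W, X)) :
  is_hom f -> is_hom g -> is_hom (g \o f)%VF.
Proof. by move=> /homP fh /homP gh; apply/homP=> t v; rewrite !comp_lfunE fh gh. Qed.

Lemma zero_hom V W : is_hom (0 : 'Hom(V, W)).
Proof. by apply/homP=> t v; rewrite !lfunE /= linear0. Qed.

Lemma submodule_full V : @is_submodule k T V fullv.
Proof. by apply/submoduleP=> t u _; apply: memvf. Qed.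

Lemma submodule_lker V W (f : 'Hom(V, W)) : is_hom f -> is_submodule (lker f).
Proof.
move=> /homP fh; apply/submoduleP=> t u; rewrite !memv_ker fh => /eqP->.
by rewrite linear0.
Qed.

Lemma submodule_img V W (f : 'Hom(V, W)) (U : {vspace V}) :
  is_hom f -> is_submodule U -> is_submodule (f @: U)%VS.
Proof.
move=> /homP fh /submoduleP HU; apply/submoduleP=> t _ /memv_imgP[u uU ->].
by rewrite -fh; apply/memv_img/HU.
Qed.

Lemma submodule_preim V W (f : 'Hom(V, W)) (U : {vspace W}) :
  is_hom f -> is_submodule U -> is_submodule (f @^-1: U)%VS.
Proof.
move=> /homP fh /submoduleP HU; apply/submoduleP=> t u.
by rewrite -!memv_preim fh; apply: HU.
Qed.

Lemma nonsimple_submodule V (U : {vspace V}) :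
    is_submodule U -> U != 0%VS -> ~ simple_submodule U ->
  exists2 W, is_submodule W & [/\ (W <= U)%VS, W != 0%VS & (\dim W < \dim U)%N].
Proof.
move=> HU U0 nsU; apply: NNPP => nex; apply: nsU; split=> // W HW WU.
have [->|W0] := eqVneq W 0%VS; [by left | right].
apply/eqP/negPn/negP=> WN; apply: nex; exists W => //; split=> //.
by rewrite ltn_neqAle dimvS // andbT (dimv_leqif_eq WU).
Qed.

Lemma simple_submodule_ex V (U : {vspace V}) : is_submodule U -> U != 0%VS ->
  exists2 S, simple_submodule S & (S <= U)%VS.
Proof.
have [n] := ubnP (\dim U); elim: n U => // n IH U dU HU U0.
have [sU|nsU] := classic (simple_submodule U); first by exists U.
have [W HW [WU W0 ltW]] := nonsimple_submodule HU U0 nsU.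
have [|S sS SW] := IH W _ HW W0; first exact: leq_trans ltW (dU : (_ <= n)%N).
by exists S => //; apply: subv_trans WU.
Qed.

Lemma maximal_submodule_ex V (U : {vspace V}) : is_submodule U -> U != fullv ->
  exists2 W, maximal_submodule W & (U <= W)%VS.
Proof.
have [n] := ubnP (\dim {:V} - \dim U); elim: n U => // n IH U dU HU U1.
have [sU|nsU] := classic (maximal_submodule U); first by exists U.
have [U' [HU' [UU' [U'1 U'N]]]] : exists U',
    is_submodule U' /\ (U <= U')%VS /\ U' != fullv /\ U != U'.
  apply: NNPP => nex; apply: nsU; split=> // U' HU' UU'.
  have [->|U'1] := eqVneq U' fullv; [by right | left].
  by apply/esym/eqP/negPn/negP=> U'N; apply: nex; exists U'.
have [|W mW UW] := IH U' _ HU' U'1; last by exists W => //; apply: subv_trans UW.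
have ltU : (\dim U < \dim U')%N.
  by rewrite ltn_neqAle dimvS // andbT (dimv_leqif_eq UU').
apply: leq_trans (dU : (_ <= n)%N); apply: ltn_sub2l => //.
by apply: leq_trans ltU _; rewrite dimvS ?subvf.
Qed.

Section Sub.
Variables (V : fdmodule k T) (U : {vspace V}) (HU : is_submodule U).

Definition sub_incl : 'Hom(submodule_module HU, V) := linfun vsval.

Lemma sub_inclE u : sub_incl u = vsval u.
Proof. by rewrite lfunE. Qed.

Lemma sub_incl_hom : is_hom sub_incl.
Proof. by apply/homP=> t u; rewrite !sub_inclE -[RHS](val_sub_act HU). Qed.

Lemma simple_sub_module : simple_submodule U -> simple_module (submodule_module HU).
Proof.
case=> _ U0 Umin; split; first exact: submodule_full.
  apply: contraNneq U0 => full0; apply/eqP/vspaceP=> u; rewrite memv0.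
  apply/idP/eqP=> [uU|->]; last exact: mem0v.
  have : vsproj U u \in @fullv k (submodule_module HU) by apply: memvf.
  by rewrite full0 memv0 => /eqP pu0; rewrite -(vsprojK uU) pu0 linear0.
move=> W HW _; have imW w : w \in W -> vsval w \in (sub_incl @: W)%VS.
  by move=> wW; rewrite -sub_inclE memv_img.
have [||W0|WU] := Umin (sub_incl @: W)%VS.
- exact: submodule_img sub_incl_hom HW.
- by apply/subvP=> _ /memv_imgP[w _ ->]; rewrite sub_inclE subvsP.
- left; apply/eqP; rewrite -subv0; apply/subvP=> w /imW; rewrite W0 !memv0.
  by rewrite -(inj_eq (@subvs_inj _ _ _)) linear0.
right; apply/eqP; rewrite eqEsubv subvf; apply/subvP=> w _.
have : vsval w \in (sub_incl @: W)%VS by rewrite WU subvsP.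
by case/memv_imgP=> w' w'W; rewrite sub_inclE => /subvs_inj->.
Qed.

Lemma hom_corestrict W (f : 'Hom(W, V)) : is_hom f -> (forall w, f w \in U) ->
  exists g : 'Hom(W, submodule_module HU), is_hom g /\ forall w, vsval (g w) = f w.
Proof.
move=> /homP fh fU; exists (linfun (vsproj U) \o f)%VF.
have gE w : vsval ((linfun (vsproj U) \o f)%VF w) = f w.
  by rewrite comp_lfunE lfunE /= vsprojK.
split=> //; apply/homP=> t w; apply: subvs_inj.
by rewrite gE fh -gE -(val_sub_act HU).
Qed.

End Sub.

Section Quotient.
Variables (V : fdmodule k T) (U : {vspace V}) (HU : is_submodule U).

Definition quot_map : 'Hom(V, quotient_module HU) := quot_proj U.

Lemma quot_map_hom : is_hom quot_map.
Proof. by apply/homP=> t v; apply: quot_proj_hom. Qed.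

Lemma quot_map_eq0 v : (quot_map v == 0) = (v \in U).
Proof. exact: quot_proj_eq0. Qed.

Lemma quot_mapK (u : quotient_module HU) : quot_map (vsval u) = u.
Proof. exact: quot_projK. Qed.

Lemma quot_map_full : limg quot_map = fullv.
Proof.
by apply/eqP; rewrite eqEsubv subvf; apply/subvP=> u _; rewrite -[u]quot_mapK memv_img ?memvf.
Qed.

Lemma simple_quotient_module : maximal_submodule U -> simple_module (quotient_module HU).
Proof.
case=> _ U1 Umax; split; first exact: submodule_full.
  apply: contraNneq U1 => full0; apply/eqP/vspaceP=> v; rewrite memvf -quot_map_eq0.
  by have : quot_map v \in fullv := memvf _; rewrite full0 memv0.
move=> W HW _; have [||WU|W1] := Umax (quot_map @^-1: W)%VS.
- exact: submodule_preim quot_map_hom HW.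
- apply/subvP=> u; rewrite -memv_preim -quot_map_eq0 => /eqP->; exact: mem0v.
- left; apply/eqP; rewrite -subv0; apply/subvP=> w wW; rewrite memv0.
  have : vsval w \in (quot_map @^-1: W)%VS by rewrite -memv_preim quot_mapK.
  by rewrite WU -quot_map_eq0 quot_mapK.
right; apply/eqP; rewrite eqEsubv subvf; apply/subvP=> w _.
by rewrite -[w]quot_mapK memv_preim W1 memvf.
Qed.

Lemma quot_map_factor W (f : 'Hom(V, W)) : is_hom f -> (U <= lker f)%VS ->
  exists g : 'Hom(quotient_module HU, W), is_hom g /\ forall v, g (quot_map v) = f v.
Proof.
move=> /homP fh /subvP Uf; exists (f \o linfun vsval)%VF.
have gE v : (f \o linfun (vsval (U:=(U^C)%VS)))%VF (quot_map v) = f v.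
  rewrite comp_lfunE lfunE; apply/eqP; rewrite -subr_eq0 -linearB -memv_ker; apply: Uf.
  by rewrite -quot_map_eq0 linearB /= quot_mapK subrr.
split=> //; apply/homP=> t u; rewrite -[u]quot_mapK.
have /homP <- := quot_map_hom; rewrite gE fh; congr (_ |> _); exact/esym/gE.
Qed.

End Quotient.

Lemma simple_hom_inj S V (f : 'Hom(S, V)) s :
  simple_module S -> is_hom f -> f s != 0 -> lker f = 0%VS.
Proof.
case=> _ _ Smin fh fs; have [//|f0] := Smin _ (submodule_lker fh) (subvf _).
by case/negP: fs; rewrite -memv_ker f0 memvf.
Qed.

Lemma simple_hom_surj V S (f : 'Hom(V, S)) v :
  simple_module S -> is_hom f -> f v != 0 -> limg f = fullv.
Proof.
case=> _ _ Smin fh fv; have [f0|//] := Smin _ (submodule_img fh (submodule_full V)) (subvf _).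
by case/negP: fv; rewrite -memv0 -f0 memv_img ?memvf.
Qed.

Lemma lfun_bijective V W (f : 'Hom(V, W)) :
  lker f = 0%VS -> limg f = fullv -> bijective f.
Proof.
move=> /eqP f0 f1; exists (f^-1)%VF => v; first exact: lker0_lfunK.
by apply: limg_lfunVK; rewrite f1 memvf.
Qed.

Lemma fullv_neq0 V (v : V) : v != 0 -> @fullv k V != 0%VS.
Proof. by apply: contraNneq => V0; rewrite -memv0 -V0 memvf. Qed.

Lemma simple_neq0 S : simple_module S -> exists s : S, s != 0.
Proof.
case=> _ S0 _; exists (vpick (@fullv k S)); by rewrite vpick0.
Qed.

End Modules.

(** * Singular vectors and coinduced modules *)

Section Singular.
Variables (k : fieldType) (M : finMonoidType) (e : idem M).
Implicit Types (X Y : fdmodule k M) (V : fdmodule k (maxsub e)).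
Local Notation E := (val e).

Definition singular X : {vspace X} :=
  (lker (fdact X E - \1%VF) :&: \bigcap_(f in below e) lker (fdact X f))%VS.

Lemma singularP X (x : X) :
  reflect (E |> x = x /\ forall f, f \in below e -> f |> x = 0) (x \in singular X).
Proof.
rewrite memv_cap memv_ker add_lfunE opp_lfunE id_lfunE subr_eq0.
apply: (iffP andP) => [[/eqP xe xf]|[xe xf]]; split=> //; last 2 first.
- exact/eqP.
- by rewrite memvE; apply/subv_bigcapP=> f fe; rewrite -memvE memv_ker xf.
move=> f fe; apply/eqP; rewrite -memv_ker memvE.
by move: xf; rewrite memvE => /subv_bigcapP; apply.
Qed.

Lemma singular_hom X Y (f : 'Hom(X, Y)) x :
  is_hom f -> x \in singular X -> f x \in singular Y.
Proof.
move=> /homP fh /singularP[xe xf]; apply/singularP; split; first by rewrite -fh xe.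
by move=> h he; rewrite -fh xf // linear0.
Qed.

Lemma singular_unit X (g : maxsub e) (x : X) :
  x \in singular X -> val g |> x \in singular X.
Proof.
move=> /singularP[xe xf]; apply/singularP; split; first by rewrite -fdactME unit_mull.
move=> f fe; have /belowP[_ ef _ _] := fe.
have -> : (f |> (val g |> x) = val g |> ((val g^-1 * f * val g)%g |> x)).
  by rewrite -!fdactME !mulgA -val_maxsubM mulgV ef.
by rewrite xf ?linear0 // below_conj.
Qed.

Definition equivariant V X (q : 'Hom(V, X)) : Prop :=
  forall g v, q (g |> v) = val g |> q v.

Definition unit_act V (x : M) : 'End(V) :=
  if insub x is Some g then fdact V g else 0.

Lemma unit_actE V (g : maxsub e) : unit_act V (val g) = fdact V g.
Proof. by rewrite /unit_act valK. Qed.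

Lemma unit_act_in V (x : M) (xU : x \in units_at E) :
  unit_act V x = fdact V (Sub x xU : maxsub e).
Proof. by rewrite /unit_act insubT. Qed.

Lemma unit_act_out V (x : M) : x \notin units_at E -> unit_act V x = 0.
Proof. by move=> xE; rewrite /unit_act insubN. Qed.

Lemma unit_act_mul V (g : maxsub e) (x : M) v : (E * x)%g = x ->
  unit_act V (val g * x)%g v = g |> unit_act V x v.
Proof.
move=> Ex; have gxU : ((val g * x)%g \in units_at E) = (x \in units_at E).
  apply/units_atP/units_atP; rewrite Rclass_mullE // => -[xE xR]; split=> //.
    have gK y : (E * y = y)%g -> (val g^-1 * (val g * y) = y)%g.
      by move=> Ey; rewrite mulgA -val_maxsubM mulVg val_maxsub1.
    have E1 : (val g * (x * E) = val g * x)%g by rewrite mulgA.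
    by rewrite -[LHS]gK ?E1 ?gK // mulgA Ex.
  by rewrite -mulgA xE.
have [xU|xU] := boolP (x \in units_at E); last first.
  by rewrite !unit_act_out ?gxU // !lfunE /= linear0.
by rewrite (unit_act_in _ xU) -fdactME -unit_actE val_maxsubM SubK.
Qed.

End Singular.

Section Coinduced.
Variables (k : fieldType) (M : finMonoidType) (e : idem M).
Local Notation E := (val e).

Section OneModule.
Variable V : fdmodule k (maxsub e).
Implicit Types (s : Coind V) (r m : M).

Definition cev_fun r s : V :=
  if insub r is Some r' then vsval s (pure (r' : Rc_type e) (1 : k^o)) else 0.

Fact cev_linear r : linear (cev_fun r).
Proof.
rewrite /cev_fun => a s t; case: insub => [r'|]; last by rewrite scaler0 addr0.
by rewrite linearP add_lfunE scale_lfunE.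
Qed.

HB.instance Definition _ r :=
  GRing.isLinear.Build k (Coind V) V *:%R (cev_fun r) (cev_linear r).

(** Evaluation of coinduced functions at [r], with value 0 for [r] outside
    [R_e], so that [cev r (m |> s) = cev (r * m) s] holds with no condition on
    [r * m]. *)
Definition cev r : 'Hom(Coind V, V) := linfun (cev_fun r).

Lemma cevE r s (rR : r \in Rclass E) :
  cev r s = vsval s (pure (Sub r rR : Rc_type e) (1 : k^o)).
Proof. by rewrite lfunE /= /cev_fun insubT. Qed.

Lemma cev_out r s : ~~ greenR E r -> cev r s = 0.
Proof. by move=> rR; rewrite lfunE /= /cev_fun insubN // inE. Qed.

Lemma cev_inj s t : (forall r, cev r s = cev r t) -> s = t.
Proof.
move=> st; apply: subvs_inj; apply: lfun_pureP => r w.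
have pw : pure r w = w *: pure r (1 : k^o).
  apply/ffunP=> x; rewrite !ffunE; case: eqP => _; last by rewrite scaler0.
  by rewrite [RHS]mulr1.
rewrite pw !linearZ /=; congr (_ *: _).
by have := st (val r); rewrite /cev !lfunE /= /cev_fun valK.
Qed.

Lemma cev_act r m s : greenR E r -> cev r (m |> s) = cev (r * m)%g s.
Proof.
move=> rR; have rR' : r \in Rclass E by rewrite inE.
have sm : vsval (m |> s) = (vsval s \o kR_ract k e m)%VF.
  by rewrite [LHS](val_sub_act (hom_G_submodule V)) [LHS]lfunE.
rewrite (cevE _ rR') sm comp_lfunE push_pure SubK lfunE /= /cev_fun.
by case: insub => // ; rewrite linear0.
Qed.

Lemma cev_act_unit (g : maxsub e) r s :
  (E * r)%g = r -> cev (val g * r)%g s = g |> cev r s.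
Proof.
move=> Er; have [rR|rR] := boolP (greenR E r); last first.
  by rewrite !cev_out ?linear0 // Rclass_mullE.
have rR' : r \in Rclass E by rewrite inE.
rewrite (cevE _ rR').
have /mem_hom_G/(_ g)/lfunP/(_ (pure (Sub r rR' : Rc_type e) (1 : k^o))) := subvsP s.
rewrite !comp_lfunE push_pure SubK => <-; rewrite lfunE /= /cev_fun.
by case: insub => // ; rewrite linear0.
Qed.

(** [Coind V] is the space of all equivariant functions from [R_e] to [V]; the
    next lemma is the version with a parameter. *)
Lemma coind_ex (F : M -> V) :
    (forall (g : maxsub e) r, greenR E r -> F (val g * r)%g = g |> F r) ->
  exists s, forall r, greenR E r -> cev r s = F r.
Proof.
move=> FG; pose phi_fun (c : kR k e) := \sum_(r : Rc_type e) (c r : k) *: F (val r).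
have [|phi phiE] := @linear_lfun _ (kR k e) V phi_fun.
  move=> a c d; rewrite /phi_fun scaler_sumr -big_split; apply: eq_bigr => r _ /=.
  by rewrite !ffunE scalerDl scalerA.
have phi1 (r : Rc_type e) (w : k^o) : phi (pure r w) = (w : k) *: F (val r).
  rewrite phiE /phi_fun (bigD1 r) //= ffunE eqxx big1 ?addr0 // => r' r'r.
  by rewrite ffunE (negPf r'r) scale0r.
have phiG : phi \in hom_G V.
  apply/mem_hom_G => g; apply: lfun_pureP => r w; rewrite !comp_lfunE push_pure.
  have rR : greenR E (val r) by have := valP r; rewrite inE.
  case: insubP => [r' _ r'E|]; last by rewrite inE Rclass_mull.
  by rewrite !phi1 linearZ /= r'E FG.
exists (Subvs phiG : Coind V) => r rR; have rR' : r \in Rclass E by rewrite inE.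
by rewrite (cevE _ rR') /= phi1 scale1r SubK.
Qed.

Lemma coind_lift (U : vectType k) (F : M -> 'Hom(U, V)) :
    (forall (g : maxsub e) r u, greenR E r -> F (val g * r)%g u = g |> F r u) ->
  exists q : 'Hom(U, Coind V), forall r u, greenR E r -> cev r (q u) = F r u.
Proof.
move=> FG; have ex u : exists s : Coind V, forall r, greenR E r -> cev r s = F r u.
  by apply: coind_ex => g r; apply: FG.
pose q u := proj1_sig (constructive_indefinite_description _ (ex u)).
have qE u r : greenR E r -> cev r (q u) = F r u.
  exact: (proj2_sig (constructive_indefinite_description _ (ex u))).
have [|Q QE] := @linear_lfun _ U (Coind V) q; last by exists Q => r u rR; rewrite QE qE.
move=> a u v; apply: cev_inj => r; have [rR|rR] := boolP (greenR E r).
  by rewrite qE // [RHS]linearP /= !qE // linearP.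
by rewrite !cev_out.
Qed.

Lemma coind_unit_ex : exists q : 'Hom(V, Coind V),
  forall r v, greenR E r -> cev r (q v) = unit_act V (r * E)%g v.
Proof.
apply: (coind_lift (F := fun r => unit_act V (r * E)%g)) => g r u rR.
by rewrite -mulgA unit_act_mul // mulgA Rclass_idl.
Qed.

(** [coind_unit v] sends [r] to [(r e) v] if [r e] is in [G_e], and to 0
    otherwise. It is the only function fixed by [e] with value [v] at [e]. *)
Definition coind_unit : 'Hom(V, Coind V) :=
  proj1_sig (constructive_indefinite_description _ coind_unit_ex).

Lemma cev_coind_unit r v :
  greenR E r -> cev r (coind_unit v) = unit_act V (r * E)%g v.
Proof. exact: (proj2_sig (constructive_indefinite_description _ coind_unit_ex)). Qed.

Lemma cev1_coind_unit v : cev E (coind_unit v) = v.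
Proof.
by rewrite cev_coind_unit ?idemR // idemE (unit_actE V 1%g) fdact1E.
Qed.

(** If [e] fixes [s], then [s r = s (r e)], and [r e] is in [G_e] as soon as it
    is in [R_e]; hence [s] is determined by its value at [e]. *)
Lemma coind_unit_eq s : E |> s = s -> s = coind_unit (cev E s).
Proof.
move=> es; apply: cev_inj => r; have [rR|rR] := boolP (greenR E r); last by rewrite !cev_out.
rewrite cev_coind_unit // -[in LHS]es cev_act //.
have [reR|reR] := boolP (greenR E (r * E)%g).
  have reU : (r * E)%g \in units_at E by apply/units_atP; rewrite -mulgA idemE.
  rewrite (unit_act_in _ reU) -cev_act_unit ?idemE //.
  by rewrite SubK -mulgA idemE.
rewrite cev_out // unit_act_out ?lfunE //.
by apply: contra reR => /units_atP[_].
Qed.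

(** The identity behind most arguments on [Coind V]: acting by [r] on a function
    extracts its value at [r]. *)
Lemma act_coind r s : greenR E r -> r |> s = coind_unit (cev r s).
Proof.
move=> rR; have Er := Rclass_idl rR.
rewrite [LHS]coind_unit_eq; last by rewrite -fdactME Er.
by rewrite cev_act ?idemR // Er.
Qed.

Lemma coind_unit_equivariant : equivariant coind_unit.
Proof.
move=> g v; have gs : E |> (val g |> coind_unit v) = val g |> coind_unit v.
  by rewrite -fdactME unit_mull.
rewrite [RHS]coind_unit_eq // cev_act ?idemR // unit_mull -[X in cev X](unit_mulr g).
by rewrite cev_act_unit ?idemE // cev1_coind_unit.
Qed.

Lemma coind_unit_singular v : coind_unit v \in singular e (Coind V).
Proof.
have es : E |> coind_unit v = coind_unit v.
  by rewrite act_coind ?idemR // cev1_coind_unit.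
apply/singularP; split=> // f /belowP[ff ef fe fNe]; apply: cev_inj => r.
have [rR|rR] := boolP (greenR E r); last by rewrite !cev_out.
rewrite linear0 cev_act //; have [rfR|rfR] := boolP (greenR E (r * f)%g); last exact: cev_out.
have rfU : (r * f)%g \in units_at E by apply/units_atP; rewrite -mulgA fe.
have /unitsP[_ [y [yE rfy yrf]]] := rfU.
by case: fNe; rewrite -ef -yrf -!mulgA ff.
Qed.

(** A non-zero submodule of [Coind V] contains [coind_unit v] for some [v != 0]
    by [act_coind], hence all of them if [V] is simple. *)
Lemma coind_unit_in (U : {vspace Coind V}) v : simple_module V ->
  is_submodule U -> U != 0%VS -> coind_unit v \in U.
Proof.
case=> _ _ Vmin /submoduleP HU U0.
pose W := (coind_unit @^-1: U)%VS.
have [] := Vmin W; rewrite ?subvf //.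
- apply/submoduleP=> g w; rewrite -!memv_preim coind_unit_equivariant; exact: HU.
- move=> W0; case/negP: U0; rewrite -subv0; apply/subvP=> s sU; rewrite memv0.
  apply/eqP/cev_inj=> r; rewrite linear0.
  have [rR|rR] := boolP (greenR E r); last exact: cev_out.
  apply/eqP; rewrite -memv0 -W0 -memv_preim -act_coind //; exact: HU.
by move=> W1; rewrite memv_preim -/W W1 memvf.
Qed.

Lemma coind_neq0 : simple_module V -> @fullv k (Coind V) != 0%VS.
Proof.
case/simple_neq0=> v v0; apply: (@fullv_neq0 _ _ _ (coind_unit v)).
by apply: contraNneq v0 => qv; rewrite -[v]cev1_coind_unit qv linear0.
Qed.

Lemma simple_coindP : simple_module V ->
  simple_module (Coind V) <->
  (forall U : {vspace Coind V}, is_submodule U ->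
     (forall v, coind_unit v \in U) -> U = fullv).
Proof.
move=> sV; split=> [[_ _ Cmin] U HU qU|CU].
  have [U0|//] := Cmin U HU (subvf _).
  have [v v0] := simple_neq0 sV; case/negP: v0.
  by have := qU v; rewrite U0 memv0 => /eqP qv; rewrite -[v]cev1_coind_unit qv linear0.
split; [exact: submodule_full|exact: coind_neq0|move=> U HU _].
have [->|U0] := eqVneq U 0%VS; [by left | right].
by apply: CU => // v; apply: coind_unit_in.
Qed.

End OneModule.

Arguments cev {V} r.

Lemma coind_map (V W : fdmodule k (maxsub e)) (q : 'Hom(V, W)) : is_hom q ->
  exists Q : 'Hom(Coind V, Coind W),
    is_hom Q /\ forall r s, cev r (Q s) = q (cev r s).
Proof.
move=> /homP qh; have [g r s rR|Q QE] := @coind_lift W (Coind V)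
  (fun r => q \o (cev r : 'Hom(Coind V, V)))%VF.
  by rewrite !comp_lfunE cev_act_unit ?qh // Rclass_idl.
have {}QE r s : cev r (Q s) = q (cev r s).
  have [rR|rR] := boolP (greenR E r); first by rewrite QE // comp_lfunE.
  by rewrite !cev_out ?linear0.
exists Q; split=> //; apply/homP=> m s; apply: cev_inj => r.
have [rR|rR] := boolP (greenR E r); last by rewrite !cev_out.
by rewrite QE !cev_act // QE.
Qed.

Lemma coind_map_unit (V W : fdmodule k (maxsub e)) (q : 'Hom(V, W))
    (Q : 'Hom(Coind V, Coind W)) v :
  is_hom Q -> (forall r s, cev r (Q s) = q (cev r s)) ->
  Q (coind_unit V v) = coind_unit W (q v).
Proof.
move=> /homP QP QE; have /singularP[ev _] := coind_unit_singular v.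
by rewrite [LHS]coind_unit_eq -?QP ?ev // QE cev1_coind_unit.
Qed.

End Coinduced.

Arguments cev {k M e V} r.

(** If [s] is fixed by [e] and [s r <> 0], then [r e] is in [R_g]; by
    [below_split], either [e J g] or [s r = s (r e f) = (f s) (r e)] for some
    [f] below [e], which is 0. *)
Lemma singular_coind_greenJ (k : fieldType) (M : finMonoidType) (e g : idem M)
    (V : fdmodule k (maxsub g)) (s : Coind V) :
  s \in singular e (Coind V) -> s != 0 -> greenJ (val e) (val g).
Proof.
move=> /singularP[es fs] s0.
have [r [rR rs]] : exists r, greenR (val g) r /\ cev r s != 0.
  apply: NNPP => nex; case/eqP: s0; apply: cev_inj => r; rewrite linear0.
  have [rR|rR] := boolP (greenR (val g) r); last exact: cev_out.
  by apply/eqP/negPn/negP=> rs; apply: nex; exists r.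
have rsE : cev (r * val e)%g s = cev r s by rewrite -cev_act // es.
have [reR|reR] := boolP (greenR (val g) (r * val e)%g); last first.
  by case/eqP: rs; rewrite -rsE cev_out.
case: (below_split reR) => [[f fe ref]|eg].
  by case/eqP: rs; rewrite -rsE -ref -cev_act // fs // linear0.
apply/greenJP; split=> //; apply/two_sidedP.
have /greenRP[_ [y gy]] := reR.
by exists r, y.
Qed.

(** * The modules [kL~_e (x) V] *)

Section Tensor.
Variables (k : fieldType) (M : finMonoidType) (e : idem M).
Local Notation E := (val e).

Fact pure_linear (W : vectType k) (I : finType) (i : I) :
  linear (pure i : W -> {ffun I -> W}).
Proof.
move=> a u v; apply/ffunP=> j; rewrite !ffunE; case: eqP => //.
by rewrite scaler0 addr0.
Qed.

HB.instance Definition _ (W : vectType k) (I : finType) (i : I) :=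
  GRing.isLinear.Build k W {ffun I -> W} *:%R (pure i) (pure_linear i).

Variables (HM : right_fountain M) (V : fdmodule k (maxsub e)).
Local Notation T := (tensor_module HM V).
Local Notation proj := (quot_map (balanced_relations_submodule HM V)).

Fact Ltilde1_subproof : E \in Ltclass E.
Proof. by rewrite inE Ltilde_refl. Qed.

Definition Lt1 : Lt_type e := Sub E Ltilde1_subproof.

(** Stated as an existence lemma so that [tensor_unit] does not unfold to a
    composition when rewriting. *)
Lemma tensor_unit_ex : exists q : 'Hom(V, T), forall v, q v = proj (pure Lt1 v).
Proof.
by exists (proj \o linfun (pure Lt1))%VF => v; rewrite comp_lfunE [linfun _ v]lfunE.
Qed.

Definition tensor_unit : 'Hom(V, T) :=
  proj1_sig (constructive_indefinite_description _ tensor_unit_ex).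

Lemma tensor_unitE v : tensor_unit v = proj (pure Lt1 v).
Proof. exact: (proj2_sig (constructive_indefinite_description _ tensor_unit_ex)). Qed.

Lemma act_tensor_unit m v :
  m |> tensor_unit v =
  if insub (m * E)%g is Some y then proj (pure (y : Lt_type e) v) else 0.
Proof.
have /homP ph := quot_map_hom (balanced_relations_submodule HM V).
rewrite tensor_unitE -ph; set z := fdact _ _ _.
have -> : z = if insub (m * E)%g is Some y then pure (y : Lt_type e) v else 0.
  exact: push_pure.
by case: insub => // ; rewrite linear0.
Qed.

Lemma proj_pure (x : Lt_type e) v : proj (pure x v) = val x |> tensor_unit v.
Proof.
have := valP x; rewrite inE => /Ltilde_mulr_fix xE.
by rewrite act_tensor_unit xE valK.
Qed.

Lemma tensor_unit_equivariant : equivariant tensor_unit.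
Proof.
move=> g v; have gL : val g \in Ltclass E.
  by rewrite inE -[val g]unit_mull Ltilde_mulr_maxsub ?Ltilde_refl.
rewrite act_tensor_unit unit_mulr insubT tensor_unitE.
apply/esym/eqP; rewrite -subr_eq0 -linearB quot_map_eq0 /= memvE.
by apply: vsum_sup; exists Lt1, (Sub (val g) gL), g, v; rewrite !SubK unit_mull.
Qed.

Lemma tensor_unit_singular v : tensor_unit v \in singular e T.
Proof.
apply/singularP; split.
  by rewrite act_tensor_unit idemE tensor_unitE insubT ?Ltilde1_subproof.
move=> f fe; have /belowP[_ _ fE _] := fe.
by rewrite act_tensor_unit fE insubN // inE below_NLtilde.
Qed.

Lemma tensor_unit_gen (U : {vspace T}) :
  is_submodule U -> (forall v, tensor_unit v \in U) -> U = fullv.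
Proof.
move=> /submoduleP HU qU; apply/eqP; rewrite eqEsubv subvf; apply/subvP=> u _.
rewrite -[u]quot_mapK [vsval u]ffun_pureE linear_sum memv_suml // => x _.
by rewrite /= proj_pure HU.
Qed.

(** [L~_e (x) V] is the free module on an equivariant copy of [V] made of
    singular vectors: if [m x] leaves [L~_e] then [m x = m x f] for some [f]
    below [e], so that [m x] kills singular vectors. *)
Lemma tensor_lift (X : fdmodule k M) (q : 'Hom(V, X)) :
    equivariant q -> (forall v, q v \in singular e X) ->
  exists h : 'Hom(T, X), is_hom h /\ forall v, h (tensor_unit v) = q v.
Proof.
move=> qG qs; pose h0_fun (F : Lt_module e V) := \sum_(x : Lt_type e) val x |> q (F x).
have [|h0 h0E] := @linear_lfun _ (Lt_module e V) X h0_fun.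
  move=> a c d; rewrite /h0_fun scaler_sumr -big_split; apply: eq_bigr => x _ /=.
  by rewrite !ffunE !linearP.
have h0_pure (x : Lt_type e) w : h0 (pure x w) = val x |> q w.
  rewrite h0E /h0_fun (bigD1 x) //= ffunE eqxx big1 ?addr0 // => y yx.
  by rewrite ffunE (negPf yx) !linear0.
have h0h : is_hom h0.
  move=> m; apply: lfun_pureP => x w.
  rewrite !comp_lfunE push_pure h0_pure -fdactME.
  have := valP x; rewrite inE => /Ltilde_mulr_fix xE.
  case: insubP => [y _ <-|]; first by rewrite h0_pure.
  rewrite inE linear0 => /(Ltilde_below HM)[|f fe <-]; first by rewrite -mulgA xE.
  by have /singularP[_ qf] := qs w; rewrite fdactME qf // linear0.
have [|h [hh hE]] := quot_map_factor (balanced_relations_submodule HM V) h0h.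
  apply: vsum_min => _ [x [y [g [v [yE ->]]]]]; rewrite -memvE memv_ker linearB /=.
  by rewrite !h0_pure yE fdactME qG subrr.
by exists h; split=> // v; rewrite tensor_unitE hE h0_pure; have /singularP[] := qs v.
Qed.

Lemma tensor_hom_ext (X : fdmodule k M) (h h' : 'Hom(T, X)) :
    is_hom h -> is_hom h' ->
  (forall v, h (tensor_unit v) = h' (tensor_unit v)) -> h = h'.
Proof.
move=> hh hh' E1; have /homP hP := hh; have /homP hP' := hh'.
have dh : is_hom (h - h')%VF.
  by apply/homP=> m u; rewrite !add_lfunE !opp_lfunE hP hP' linearB.
have K1 : lker (h - h')%VF = fullv.
  apply: tensor_unit_gen (submodule_lker dh) _ => v.
  by rewrite memv_ker add_lfunE opp_lfunE E1 subrr.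
apply/lfunP=> u; apply/eqP; rewrite -subr_eq0 -opp_lfunE -add_lfunE -memv_ker K1.
exact: memvf.
Qed.

End Tensor.

(** * The simple modules of a finite monoid *)

Section LocalModule.
Variables (k : fieldType) (M : finMonoidType) (e : idem M) (X : fdmodule k M).
Local Notation E := (val e).
Local Notation eX := (limg (fdact X E)).

Lemma mem_local x : reflect (E |> x = x) (x \in eX).
Proof.
apply: (iffP memv_imgP) => [[y _ ->]|ex]; first by rewrite -fdactME idemE.
by exists x; rewrite ?memvf.
Qed.

Definition local_act (g : maxsub e) : 'End(subvs_of eX) :=
  (linfun (vsproj eX) \o fdact X (val g) \o linfun vsval)%VF.

Lemma val_local_act g u : vsval (local_act g u) = val g |> vsval u.
Proof.
rewrite /local_act !comp_lfunE !lfunE /= vsprojK //.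
by apply/mem_local; rewrite -fdactME unit_mull.
Qed.

Fact local_act1 : local_act 1%g = \1%VF.
Proof.
apply/lfunP=> u; apply: subvs_inj; rewrite val_local_act id_lfunE.
exact/mem_local/subvsP.
Qed.

Fact local_actM s t : local_act (s * t)%g = (local_act s \o local_act t)%VF.
Proof.
apply/lfunP=> u; apply: subvs_inj.
by rewrite comp_lfunE !val_local_act val_maxsubM fdactME.
Qed.

(** The [G_e]-module [e X]. *)
Definition local_module : fdmodule k (maxsub e) := FdModule local_act1 local_actM.

Definition local_incl : 'Hom(local_module, X) := linfun vsval.

Lemma local_inclE w : local_incl w = vsval w.
Proof. by rewrite lfunE. Qed.

End LocalModule.

Section SimpleModules.
Variables (k : fieldType) (M : finMonoidType).

(** An element [x] acting nontrivially on [S] with [MxM] minimal generates a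
    regular [J]-class: some [x z x] acts nontrivially, so it generates the same
    ideal, and [x = (u x z)^p x v^p] for all [p] then yields an idempotent. *)
Lemma apex_ex (S : fdmodule k M) : simple_module S ->
  exists2 e : idem M, fdact S (val e) != 0 &
    forall x, x \in two_sided (val e) -> ~~ greenJ (val e) x -> fdact S x = 0.
Proof.
move=> sS; have [s0 s0N0] := simple_neq0 sS.
have S1 : fdact S 1%g != 0.
  by apply: contraNneq s0N0 => S10; rewrite -[s0]fdact1E S10 lfunE.
have [x xN0 xmin] := arg_minnP (P := fun x => fdact S x != 0) (fun x : M => #|two_sided x|) S1.
(* Otherwise the vectors killed by all [x z] form a submodule that contains [x S];
   it does not contain [s], so it is 0. *)
have [z xzxN0] : exists z, fdact S (x * z * x)%g != 0.
  apply: NNPP => nex; have [s xs] := lfun_neq0 xN0.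
  pose U := (\bigcap_(z : M) lker (fdact S (x * z)%g))%VS.
  have UP u : reflect (forall z, (x * z)%g |> u = 0) (u \in U).
    rewrite memvE; apply: (iffP subv_bigcapP) => H z; have := H z.
      by rewrite -memvE memv_ker => /(_ isT)/eqP.
    by rewrite -memvE memv_ker => ->.
  have HU : is_submodule U.
    by apply/submoduleP=> t u /UP uU; apply/UP=> z; rewrite -fdactME -mulgA uU.
  have [_ _ Smin] := sS; have [U0|U1] := Smin U HU (subvf _).
    case/eqP: xs; apply/eqP; rewrite -memv0 -U0; apply/UP=> z; rewrite -fdactME.
    have [->|N0] := eqVneq (fdact S (x * z * x)%g) 0; first by rewrite lfunE.
    by case: nex; exists z.
  have /UP/(_ 1%g) : s \in U by rewrite U1 memvf.
  by rewrite mulg1 => /eqP; apply/negP.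
have xzxJ y : y \in two_sided x -> fdact S y != 0 -> two_sided y = two_sided x.
  rewrite -two_sided_sub => yx yN0; apply/eqP; rewrite eqEcard yx; exact: xmin.
have xzx : (x * z * x)%g \in two_sided x.
  by apply/two_sidedP; exists (x * z)%g, 1%g; rewrite mulg1.
have := two_sided_refl x; rewrite -(xzxJ _ xzx xzxN0) => /two_sidedP[u [v xE]].
have it p : x = ((u * x * z) ^+ p * x * v ^+ p)%g.
  elim: p => [|p IH]; first by rewrite !expg0 mul1g mulg1.
  by rewrite [LHS]IH {2}xE expgSr (expgS v) !mulgA.
have [N NI] := idempotent_pow (u * x * z)%g.
pose e : idem M := exist _ ((u * x * z) ^+ N.+1)%g NI.
have eN0 : fdact S (val e) != 0.
  apply: contraNneq xN0 => e0; rewrite (it N.+1) !fdactM.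
  rewrite (e0 : fdact S ((u * x * z) ^+ N.+1)%g = 0).
  by rewrite !comp_lfun0l.
have ex : val e \in two_sided x.
  by apply/two_sidedP; exists ((u * x * z) ^+ N * u)%g, z; rewrite /= expgSr !mulgA.
have eJ := xzxJ _ ex eN0; exists e => // y; rewrite -[y \in _]two_sided_sub eJ => ye nJ.
apply/eqP/negPn/negP=> yN0; case/negP: nJ; rewrite /greenJ -/(two_sided _) -/(two_sided y).
by rewrite eJ (xzxJ y) // -two_sided_sub.
Qed.

Lemma simple_apex (n : nat) (e : 'I_n -> idem M) (S : fdmodule k M) :
    regularJ_representatives e -> simple_module S ->
  exists i, fdact S (val (e i)) != 0 /\
    forall x, x \in two_sided (val (e i)) -> ~~ greenJ (val (e i)) x -> fdact S x = 0.
Proof.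
move=> He /apex_ex[f fN0 fmin].
have fJ : regularJ (val f) by apply/existsP; exists (val f); rewrite inE greenJ_refl (valP f).
have [i [+ _]] := He _ fJ; rewrite inE => fe; exists i.
have /greenJP[ef /two_sidedP[x [y fE]]] := fe; split.
  by apply: contraNneq fN0 => e0; rewrite fE !fdactM e0 comp_lfun0r comp_lfun0l.
move=> z ze zJ; apply: fmin; last by apply: contra zJ; apply: greenJ_trans; rewrite greenJ_sym.
by move: ze; rewrite -!two_sided_sub => /subset_trans; apply; rewrite two_sided_sub.
Qed.

Section Apex.
Variables (e : idem M) (S : fdmodule k M).
Hypothesis sS : simple_module S.
Hypothesis eN0 : fdact S (val e) != 0.
Hypothesis apexS :
  forall x, x \in two_sided (val e) -> ~~ greenJ (val e) x -> fdact S x = 0.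
Local Notation E := (val e).
Local Notation W := (local_module e S).

Lemma apex_act0 x : (E * x)%g = x -> ~~ greenR E x -> fdact S x = 0.
Proof.
move=> Ex nR; have xe : x \in two_sided E.
  by apply/two_sidedP; exists 1%g, x; rewrite mul1g.
apply: apexS => //; apply: contra nR => /greenJP[_].
by rewrite -Ex; apply: stable_right.
Qed.

Lemma local_simple : simple_module W.
Proof.
split; first exact: submodule_full.
  have [s es] := lfun_neq0 eN0.
  have esW : E |> s \in limg (fdact S E) by rewrite memv_img ?memvf.
  apply: (@fullv_neq0 _ _ _ (Subvs esW : W)).
  by rewrite -(inj_eq (@subvs_inj _ _ _)) linear0.
move=> U /submoduleP HU _; have [->|U0] := eqVneq U 0%VS; [by left | right].
(* The elements [s] of [S] such that [e M s] lies in [U] form a submodule. *)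
pose Y := (\bigcap_(m : M) (fdact S (E * m)%g @^-1: (linfun vsval @: U)))%VS.
have YP y : reflect (forall m, (E * m)%g |> y \in (linfun vsval @: U)%VS) (y \in Y).
  rewrite memvE; apply: (iffP subv_bigcapP) => H m; have := H m.
    by rewrite -memvE -memv_preim; apply.
  by rewrite -memvE -memv_preim.
have HY : is_submodule Y.
  by apply/submoduleP=> t y /YP yY; apply/YP=> m; rewrite -fdactME -mulgA.
have UY (u : W) : u \in U -> vsval u \in Y.
  move=> uU; apply/YP=> m; have uE : E |> vsval u = vsval u by apply/mem_local/subvsP.
  rewrite -uE -fdactME.
  have [mR|mR] := boolP (greenR E (E * m * E)%g); last first.
    by rewrite apex_act0 ?lfunE ?mem0v //= !mulgA idemE.
  have mU : (E * m * E)%g \in units_at E by apply/units_atP; rewrite -mulgA idemE.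
  rewrite -[X in X |> _](SubK (maxsub e) mU) -val_local_act.
  have := memv_img (linfun vsval) (HU (Sub (E * m * E)%g mU : maxsub e) u uU).
  by rewrite lfunE.
have Y1 : Y = fullv.
  have [_ _ Smin] := sS; have [Y0|//] := Smin Y HY (subvf _).
  case/negP: U0; rewrite -subv0; apply/subvP=> u /UY; rewrite Y0 !memv0.
  by rewrite -(inj_eq (@subvs_inj _ _ _)) linear0.
apply/eqP; rewrite eqEsubv subvf; apply/subvP=> u _.
have /YP/(_ 1%g) : vsval u \in Y by rewrite Y1 memvf.
rewrite mulg1 (mem_local _ _ (subvsP u)) => /memv_imgP[w wU]; rewrite lfunE.
by move/subvs_inj->.
Qed.

Lemma local_incl_singular : exists q : 'Hom(W, S),
  [/\ equivariant q, forall w, q w \in singular e S & exists w, q w != 0].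
Proof.
exists (local_incl e S); split.
- by move=> g w; rewrite !local_inclE; apply: val_local_act.
- move=> w; rewrite local_inclE; apply/singularP; split; first exact/mem_local/subvsP.
  move=> f /belowP[ff ef fe fNe]; rewrite apex_act0 ?lfunE //.
  apply/negP=> /greenRP[_ [y Ey]]; apply: fNe.
  by rewrite -fe Ey mulgA ff.
have [w w0] := simple_neq0 local_simple; exists w; rewrite local_inclE.
by rewrite -(inj_eq (@subvs_inj _ _ _)) linear0 in w0.
Qed.

(** The vector [s] goes to the function [r |-> r s]; this is a homomorphism since
    elements of [e M] outside [R_e] annihilate [S]. *)
Lemma local_coind : exists q : 'Hom(S, Coind W), is_hom q /\ lker q = 0%VS.
Proof.
have projK x : E |> x = x -> vsval (vsproj (limg (fdact S E)) x) = x.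
  by move=> xe; rewrite vsprojK //; apply/mem_local.
have [g r s rR|q qE] := @coind_lift _ _ _ W S
    (fun r => linfun (vsproj (limg (fdact S E))) \o fdact S r)%VF.
  apply: subvs_inj; rewrite val_local_act !comp_lfunE !lfunE /=.
  have Er := Rclass_idl rR.
  by rewrite !projK -?fdactME ?Er // mulgA unit_mull.
have {}qE r s : greenR E r -> vsval (cev r (q s)) = r |> s.
  move=> rR; rewrite qE // comp_lfunE lfunE /= projK // -fdactME Rclass_idl //.
have qh : is_hom q.
  apply/homP=> m s; apply: cev_inj => r.
  have [rR|rR] := boolP (greenR E r); last by rewrite !cev_out.
  rewrite cev_act //; have [rmR|rmR] := boolP (greenR E (r * m)%g).
    by apply: subvs_inj; rewrite !qE // fdactME.
  rewrite [RHS]cev_out //; apply: subvs_inj.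
  rewrite qE // -fdactME apex_act0 ?lfunE ?linear0 //.
  by rewrite mulgA Rclass_idl.
exists q; split=> //.
have [w1 w1N0] := simple_neq0 local_simple.
apply: (simple_hom_inj (s := vsval w1) sS qh).
apply: contraNneq w1N0 => qw; apply/eqP/subvs_inj; rewrite linear0.
by rewrite -(mem_local _ _ (subvsP w1)) -qE ?idemR // qw linear0 linear0.
Qed.

End Apex.

Lemma simple_module_apex (n : nat) (e : 'I_n -> idem M) (S : fdmodule k M) :
    regularJ_representatives e -> simple_module S ->
  exists (i : 'I_n) (W : fdmodule k (maxsub (e i))), simple_module W /\
    (exists q : 'Hom(W, S),
       [/\ equivariant q, forall w, q w \in singular (e i) S & exists w, q w != 0]) /\
    (exists q : 'Hom(S, Coind W), is_hom q /\ lker q = 0%VS).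
Proof.
move=> He sS; have [i [eN0 apexS]] := simple_apex He sS.
exists i, (local_module (e i) S); split; first exact: local_simple.
by split; [apply: local_incl_singular | apply: local_coind].
Qed.

End SimpleModules.

(** * Lifting singular vectors *)

Section Lifting.
Variables (k : fieldType) (M : finMonoidType).
Implicit Types (A B : fdmodule k M).

(** Identify [Coind V] with its image. The required function [s] must satisfy
    [e s = s] and [f s = f a] for [f] below [e], and it is given by
    [s r = (r e a) (g)] if [r e = r e f] for some such [f] (in which case [r e a]
    lies in [Coind V]), and [s r = 0] otherwise. Then [a' = a - s]. *)
Lemma singular_lift_coind (e g : idem M) (V : fdmodule k (maxsub g)) A
    (q : 'Hom(Coind V, A)) (a : A) :
    is_hom q -> lker q = 0%VS -> val e |> a = a ->
    (forall f, f \in below e -> f |> a \in limg q) ->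
  exists2 a', a' \in singular e A & a - a' \in limg q.
Proof.
move=> /homP qh /eqP q0 ea fa; pose c : 'Hom(A, Coind V) := (q^-1)%VF.
have qK s : c (q s) = s by apply: lker0_lfunK.
have cK t : t \in limg q -> q (c t) = t by apply: limg_lfunVK.
pose F r : V := if [exists f in below e, (r * val e * f == r * val e)%g]
  then cev (val g) (c ((r * val e)%g |> a)) else 0.
have FE r f : greenR (val g) r -> f \in below e -> (r * val e * f = r * val e)%g ->
    F r = cev (r * val e)%g (c (f |> a)).
  move=> rR fe rf; rewrite /F; case: existsP => [_|[]]; last by exists f; rewrite fe rf eqxx.
  rewrite -rf fdactME -(cK _ (fa f fe)) -qh !qK cev_act ?idemR //.
  by rewrite !mulgA Rclass_idl // rf.
have F0 r : (forall f, f \in below e -> (r * val e * f)%g <> (r * val e)%g) -> F r = 0.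
  by move=> nf; rewrite /F; case: existsP => // -[f /andP[fe /eqP/nf]]; case.
have Fcase r : (exists2 f, f \in below e & (r * val e * f = r * val e)%g) \/
    (forall f, f \in below e -> (r * val e * f)%g <> (r * val e)%g).
  have [[f fe rf]|nf] := classic (exists2 f, f \in below e & (r * val e * f = r * val e)%g).
    by left; exists f.
  by right=> f fe rf; apply: nf; exists f.
have [u r rR|s sE] := coind_ex (F := F).
  have urR : greenR (val g) (val u * r)%g by apply: Rclass_mull.
  case: (Fcase r) => [[f fe rf]|nf].
    rewrite !(FE _ f) //; last by rewrite -!mulgA (mulgA r) rf.
    by rewrite -mulgA cev_act_unit // mulgA Rclass_idl.
  rewrite !F0 ?linear0 // => f fe urf; apply: (nf f fe).
  have uu x : (val g * x = x)%g -> (val u^-1 * (val u * x) = x)%g.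
    by move=> gx; rewrite mulgA -val_maxsubM mulVg val_maxsub1.
  have gr := Rclass_idl rR.
  have E1 : (val u * (r * val e * f) = val u * (r * val e))%g by rewrite !mulgA.
  by rewrite -[LHS]uu ?E1 ?uu // !mulgA gr.
have es : val e |> s = s.
  apply: cev_inj => r; have [rR|rR] := boolP (greenR (val g) r); last by rewrite !cev_out.
  rewrite cev_act // [RHS]sE //; have [reR|reR] := boolP (greenR (val g) (r * val e)%g).
    by rewrite sE // /F -!(mulgA r) idemE.
  rewrite cev_out //; case: (Fcase r) => [[f fe rf]|nf]; last by rewrite F0.
  by rewrite (FE _ _ rR fe rf) cev_out.
have fs f : f \in below e -> f |> s = c (f |> a).
  move=> fe; have /belowP[ff ef fE _] := fe.
  have -> : c (f |> a) = f |> c (f |> a).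
    by rewrite -{1}ff fdactME -{1}(cK _ (fa f fe)) -qh qK.
  apply: cev_inj => r; have [rR|rR] := boolP (greenR (val g) r); last by rewrite !cev_out.
  rewrite !cev_act //.
  have [rfR|rfR] := boolP (greenR (val g) (r * f)%g); last by rewrite !cev_out.
  have rfe : (r * f * val e = r * f)%g by rewrite -mulgA fE.
  by rewrite sE // (FE _ f) ?rfe // -mulgA ff.
exists (a - q s); last by rewrite opprB addrC subrK memv_img ?memvf.
apply/singularP; split; first by rewrite linearB /= ea -qh es.
by move=> f fe; rewrite linearB /= -qh fs // cK ?subrr // fa.
Qed.

Variables (n : nat) (e : 'I_n -> idem M) (He : regularJ_representatives e).
Hypothesis coind_simple : forall (i : 'I_n) (V : fdmodule k (maxsub (e i))),
  simple_module V -> simple_module (Coind V).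

(** Induction on [dim K]: lift first to the quotient by a simple submodule of
    [K], which is a coinduced module by hypothesis, and correct the lift by
    [singular_lift_coind]. *)
Lemma singular_lift (d : idem M) A (K : {vspace A}) (a : A) :
    is_submodule K -> val d |> a = a -> (forall f, f \in below d -> f |> a \in K) ->
  exists2 a', a' \in singular d A & a - a' \in K.
Proof.
have [m] := ubnP (\dim K); elim: m A K a => // m IH A K a dK HK da fa.
have [K0|K0] := eqVneq K 0%VS.
  exists a; last by rewrite subrr mem0v.
  by apply/singularP; split=> // f /fa; rewrite K0 memv0 => /eqP.
have [S sS SK] := simple_submodule_ex HK K0; have [HS S0 _] := sS.
have sSm := simple_sub_module HS sS.
have [i [W [sW [_ [q [qh q0]]]]]] := simple_module_apex He sSm.
have q1 : limg q = fullv.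
  have [s sN0] := simple_neq0 sSm; apply: (simple_hom_surj (v := s) (coind_simple sW) qh).
  by rewrite -memv_ker q0 memv0.
pose c : 'Hom(Coind W, A) := (sub_incl HS \o q^-1)%VF.
have qK s : q ((q^-1)%VF s) = s by apply: limg_lfunVK; rewrite q1 memvf.
have cK s : c (q s) = vsval s.
  by rewrite comp_lfunE lker0_lfunK ?q0 // sub_inclE.
have ch : is_hom c.
  have /homP qP := qh; have /homP iP := sub_incl_hom HS.
  by apply/homP=> t s; rewrite -[s]qK -qP !cK -!sub_inclE iP.
have cS : limg c = S.
  apply/eqP; rewrite eqEsubv; apply/andP; split; apply/subvP=> x.
    by case/memv_imgP=> s _ ->; rewrite -[s]qK cK subvsP.
  by move=> xS; rewrite -(vsprojK xS) -cK memv_img ?memvf.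
have c0 : lker c = 0%VS.
  apply/eqP; rewrite -subv0; apply/subvP=> s; rewrite memv_ker memv0 -{1}[s]qK cK => s0.
  have : (q^-1)%VF s == 0 by rewrite -(inj_eq (@subvs_inj _ _ _)) linear0.
  by move=> /eqP s1; rewrite -[s]qK s1 linear0.
pose p := quot_map HS; have ph : is_hom p := quot_map_hom HS; have /homP pP := ph.
have pS x : (p x == 0) = (x \in S) := quot_map_eq0 HS x.
have [|||f fd|a1 a1s a1K] := IH (quotient_module HS) (p @: K)%VS (p a).
- apply: leq_trans (dK : (_ <= m)%N); rewrite -(limg_ker_dim p K).
  rewrite -[X in (X < _)%N]add0n ltn_add2r lt0n.
  rewrite dimv_eq0; apply: contraNneq S0 => KS0; rewrite -subv0 -KS0 subv_cap SK.
  by apply/subvP=> x; rewrite memv_ker pS.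
- exact: submodule_img.
- by rewrite -pP da.
- by rewrite -pP memv_img ?fa.
pose a0 := val d |> (vsval a1 : A).
have pa0 : p a0 = a1 by rewrite pP [p _]quot_mapK; have /singularP[] := a1s.
have [|f fd|a' a's aa'] := singular_lift_coind (e := d) (a := a0) ch c0.
- by rewrite -fdactME idemE.
- by rewrite cS -pS pP pa0; have /singularP[_ ->] := a1s.
exists a' => //; rewrite cS -pS linearB /= pa0 subr_eq0 in aa'.
have : p (a - a') \in (p @: K)%VS by rewrite linearB /= -(eqP aa').
case/memv_imgP=> x xK paa; rewrite -(subrK x (a - a')); apply: memvD => //.
by apply: (subvP SK); rewrite -pS linearB /= paa subrr.
Qed.

End Lifting.

(** * Averaging over a maximal subgroup *)

Section Average.
Variables (k : fieldType) (M : finMonoidType) (e : idem M).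
Hypothesis Ge : (#|{: maxsub e}|%:R : k) != 0.

(** The average [q'] of [q] over the group. The second conclusion transfers to
    [q'] any linear condition, with constant value, shared by the translates of
    [q]: it serves to keep sections and to stay inside a subspace. *)
Lemma average (V : fdmodule k (maxsub e)) (X : vectType k)
    (rho : maxsub e -> 'End(X)) (q : 'Hom(V, X)) :
    (forall g h x, rho (g * h)%g x = rho g (rho h x)) ->
  exists q' : 'Hom(V, X), (forall g v, q' (g |> v) = rho g (q' v)) /\
    forall (Y : vectType k) (p : 'Hom(X, Y)) v y,
      (forall g, p (rho g (q (g^-1%g |> v))) = y) -> p (q' v) = y.
Proof.
move=> rhoM; pose q' := #|{: maxsub e}|%:R^-1 *: (\sum_g (rho g \o q \o fdact V g^-1%g)%VF).
have q'E v : q' v = #|{: maxsub e}|%:R^-1 *: \sum_g rho g (q (g^-1%g |> v)).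
  rewrite scale_lfunE sum_lfunE; congr (_ *: _); apply: eq_bigr => g _.
  by rewrite !comp_lfunE.
exists q'; split=> [h v|Y p v y py].
  rewrite !q'E linearZ /=; congr (_ *: _); rewrite linear_sum.
  rewrite (reindex_inj (mulgI h)); apply: eq_bigr => g _ /=.
  by rewrite rhoM -fdactME invMg -mulgA mulVg mulg1.
rewrite q'E linearZ /= (_ : p _ = \sum_(g : maxsub e) y); last first.
  by rewrite linear_sum; apply: eq_bigr => g _; apply: py.
by rewrite sumr_const -[y *+ _]scaler_nat scalerA mulVf ?scale1r.
Qed.

End Average.

(** * Homomorphisms from [kL~_e (x) V] to coinduced modules *)

Section TensorCoind.
Variables (k : fieldType) (M : finMonoidType) (HM : right_fountain M).

Lemma tensor_to_coind_greenJ (e g : idem M) (V : fdmodule k (maxsub e))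
    (W : fdmodule k (maxsub g)) (h : 'Hom(tensor_module HM V, Coind W)) :
  is_hom h -> h != 0 -> greenJ (val e) (val g).
Proof.
move=> hh h0; have [v hv] : exists v, h (tensor_unit HM V v) != 0.
  apply: NNPP => nex; case/eqP: h0; apply: tensor_hom_ext => //; first exact: zero_hom.
  by move=> v; rewrite [RHS]lfunE /=; apply/eqP/negPn/negP=> hv; apply: nex; exists v.
by apply: (singular_coind_greenJ _ hv); apply/singular_hom/tensor_unit_singular.
Qed.

Variable e : idem M.
Implicit Types V W : fdmodule k (maxsub e).
Local Notation E := (val e).

Lemma tensor_coind_ex V : exists q : 'Hom(tensor_module HM V, Coind V),
  is_hom q /\ forall v, q (tensor_unit HM V v) = coind_unit V v.
Proof.
apply: tensor_lift; [exact: coind_unit_equivariant | exact: coind_unit_singular].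
Qed.

Definition tensor_coind V : 'Hom(tensor_module HM V, Coind V) :=
  proj1_sig (constructive_indefinite_description _ (tensor_coind_ex V)).

Lemma tensor_coind_hom V : is_hom (tensor_coind V).
Proof. exact: (proj2_sig (constructive_indefinite_description _ (tensor_coind_ex V))).1. Qed.

Lemma tensor_coind_unit V v : tensor_coind V (tensor_unit HM V v) = coind_unit V v.
Proof. exact: (proj2_sig (constructive_indefinite_description _ (tensor_coind_ex V))).2. Qed.

Lemma tensor_to_coind V W (h : 'Hom(tensor_module HM V, Coind W)) : is_hom h ->
  exists a : 'Hom(V, W), is_hom a /\ forall v, h (tensor_unit HM V v) = coind_unit W (a v).
Proof.
move=> hh; exists (cev E \o h \o tensor_unit HM V)%VF.
have hE v : E |> h (tensor_unit HM V v) = h (tensor_unit HM V v).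
  by have /(singular_hom hh)/singularP[] := tensor_unit_singular HM v.
split=> [|v]; last by rewrite [LHS]coind_unit_eq // !comp_lfunE.
apply/homP=> g v; rewrite !comp_lfunE tensor_unit_equivariant.
have /homP -> := hh; rewrite cev_act ?idemR // unit_mull -[X in cev X](unit_mulr g).
by rewrite cev_act_unit ?idemE.
Qed.

Lemma tensor_coind_lker V W (h : 'Hom(tensor_module HM V, Coind W)) :
  is_hom h -> (lker (tensor_coind V) <= lker h)%VS.
Proof.
move=> hh; have [a [ah hE]] := tensor_to_coind hh.
have [Q [Qh QE]] := coind_map ah.
have -> : h = (Q \o tensor_coind V)%VF.
  apply: tensor_hom_ext => //; first exact: hom_comp (tensor_coind_hom V) Qh.
  by move=> v; rewrite comp_lfunE tensor_coind_unit hE (coind_map_unit _ Qh QE).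
apply/subvP=> x; rewrite !memv_ker comp_lfunE => /eqP->.
by rewrite linear0.
Qed.

(** [T] is generated by the vectors [tensor_unit v], and [h] sends these to
    vectors of the form [coind_unit w]. *)
Lemma tensor_to_coind_sub V W (h : 'Hom(tensor_module HM V, Coind W))
    (U : {vspace Coind W}) x :
  is_hom h -> is_submodule U -> (forall w, coind_unit W w \in U) -> h x \in U.
Proof.
move=> hh HU qU; have [a [_ hE]] := tensor_to_coind hh.
rewrite memv_preim (tensor_unit_gen (U := h @^-1: U)%VS) ?memvf //.
  exact: submodule_preim.
by move=> v; rewrite -memv_preim hE.
Qed.

Lemma tensor_coind_neq0 V : simple_module V -> exists x, tensor_coind V x != 0.
Proof.
move=> /simple_neq0[v v0]; exists (tensor_unit HM V v); rewrite tensor_coind_unit.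
by apply: contraNneq v0 => qv; rewrite -[v]cev1_coind_unit qv linear0.
Qed.

End TensorCoind.

(** * Simplicity of coinduced modules and projective covers *)

Section ProjectiveCovers.
Variables (M : finMonoidType) (HM : right_fountain M) (k : fieldType).
Variables (n : nat) (e : 'I_n -> idem M) (He : regularJ_representatives e).

Lemma representatives_inj i j : greenJ (val (e i)) (val (e j)) -> i = j.
Proof.
move=> ij; have iJ : regularJ (val (e i)).
  by apply/existsP; exists (val (e i)); rewrite inE greenJ_refl (valP (e i)).
have [l [_ lU]] := He iJ; rewrite -(lU i) ?inE ?greenJ_refl //.
by apply: lU; rewrite inE.
Qed.

Section CoindSimple.
Hypothesis coind_simple : forall (i : 'I_n) (V : fdmodule k (maxsub (e i))),
  simple_module V -> simple_module (Coind V).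
Variables (i : 'I_n) (V : fdmodule k (maxsub (e i))).
Hypothesis sV : simple_module V.
Local Notation T := (tensor_module HM V).
Local Notation C := (tensor_coind HM V).

Lemma tensor_coind_full : limg C = fullv.
Proof.
have [x Cx] := tensor_coind_neq0 HM sV.
exact: simple_hom_surj (coind_simple sV) (tensor_coind_hom HM V) Cx.
Qed.

(** The quotient of [T] by a maximal submodule embeds in some [Coind W], so that
    the submodule is the kernel of a map [T -> Coind W], which factors through
    [tensor_coind]. *)
Lemma maximal_submodule_tensor (U : {vspace T}) : maximal_submodule U ->
  U = lker C.
Proof.
move=> mU; have [HU U1 Umax] := mU.
have sS := simple_quotient_module HU mU.
have [j [W [_ [_ [q [qh q0]]]]]] := simple_module_apex He sS.
pose h := (q \o quot_map HU)%VF.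
have hh : is_hom h := hom_comp (quot_map_hom HU) qh.
have Uh : U = lker h.
  apply/vspaceP=> x; rewrite memv_ker comp_lfunE -memv_ker q0 memv0.
  exact/esym/quot_map_eq0.
have h0 : h != 0.
  apply: contraNneq U1 => h0; rewrite Uh h0; apply/eqP/vspaceP=> x.
  by rewrite memv_ker lfunE memvf /= eqxx.
have ij := representatives_inj (tensor_to_coind_greenJ hh h0).
have CU : (lker C <= U)%VS.
  rewrite Uh; case: j / ij W q qh q0 h hh Uh h0 => W q qh q0 h hh Uh h0.
  exact: tensor_coind_lker.
have /homP CP := tensor_coind_hom HM V.
have [_ _ Cmin] := coind_simple sV.
have [CU0|CU1] := Cmin _ (submodule_img (tensor_coind_hom HM V) HU) (subvf _).
  apply/eqP; rewrite eqEsubv CU andbT; apply/subvP=> x xU.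
  by rewrite memv_ker -memv0 -CU0 memv_img.
case/eqP: U1; apply/eqP; rewrite eqEsubv subvf; apply/subvP=> x _.
have : C x \in (C @: U)%VS by rewrite CU1 memvf.
case/memv_imgP=> y yU Cxy; rewrite -(subrK y x) memvD //.
by apply: (subvP CU); rewrite memv_ker linearB /= Cxy subrr.
Qed.

Lemma tensor_proper_submodule (U : {vspace T}) :
  is_submodule U -> U != fullv -> (U <= lker C)%VS.
Proof.
by move=> HU /(maximal_submodule_ex HU)[W /maximal_submodule_tensor->].
Qed.

Lemma lker_tensor_coind_neq : lker C != fullv.
Proof.
have [x] := tensor_coind_neq0 HM sV; rewrite -memv_ker; apply: contraNneq => ->.
by rewrite memvf.
Qed.

Lemma radical_tensor : radical T = lker C.
Proof.
have mC : maximal_submodule (lker C).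
  have HC := submodule_lker (tensor_coind_hom HM V).
  have [W mW] := maximal_submodule_ex HC lker_tensor_coind_neq.
  by rewrite -(maximal_submodule_tensor mW).
apply/vspaceP=> x; apply/idP/idP; first by move/mem_vcap; apply.
by move=> xC; apply/mem_vcap=> W /maximal_submodule_tensor->.
Qed.

Lemma tensor_indecomposable : indecomposable T.
Proof.
have [x Cx] := tensor_coind_neq0 HM sV; split.
  by apply: (@fullv_neq0 _ _ _ x); apply: contraNneq Cx => ->; rewrite linear0.
move=> U W HU HW UW1 UW0.
have [U1|U1] := eqVneq U fullv; first by right; rewrite -UW0 U1 capfv.
have [W1|W1] := eqVneq W fullv; first by left; rewrite -UW0 W1 capvf.
case/negP: lker_tensor_coind_neq; rewrite eqEsubv subvf -UW1 subv_add.
by rewrite !tensor_proper_submodule.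
Qed.

Lemma head_tensor : isomorphic (head_module T) (sharp V).
Proof.
have socC s : s \in socle (Coind V) by apply/(subvP (vsum_sup (coind_simple sV)))/memvf.
have [h [hh hE]] := hom_corestrict (socle_submodule (Coind V)) (tensor_coind_hom HM V)
  (fun x => socC _).
have h0 : lker h = lker C.
  by apply/vspaceP=> x; rewrite !memv_ker -(inj_eq (@subvs_inj _ _ _)) hE linear0.
have [|q [qh qE]] := quot_map_factor (radical_submodule T) hh.
  by rewrite radical_tensor h0.
have Cr : (lker C <= radical T)%VS by rewrite radical_tensor.
exists q; split=> //; apply: lfun_bijective.
  apply/eqP; rewrite -subv0; apply/subvP=> x; rewrite memv_ker memv0 -[x]quot_mapK qE.
  by rewrite -memv_ker h0 quot_map_eq0; apply: (subvP Cr).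
apply/eqP; rewrite eqEsubv subvf; apply/subvP=> s _.
have : vsval s \in limg C by rewrite tensor_coind_full memvf.
case/memv_imgP=> x _ sx; have -> : s = q (quot_map (radical_submodule T) x).
  by apply: subvs_inj; rewrite qE hE.
by rewrite memv_img ?memvf.
Qed.

Hypothesis Ge : (#|{: maxsub (e i)}|%:R : k) != 0.

(** Maps out of [T] are equivariant maps from [V] to singular vectors, so that
    [singular_lift] and averaging solve the lifting problem. *)
Lemma tensor_projective : projective T.
Proof.
move=> A B p f ph p1 fh.
pose q := (f \o tensor_unit HM V)%VF.
have qG : equivariant q.
  by move=> g v; have /homP fP := fh; rewrite !comp_lfunE tensor_unit_equivariant fP.
have qs v : q v \in singular (e i) B.
  by rewrite comp_lfunE; apply/singular_hom/tensor_unit_singular.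
(* A linear, not yet equivariant, lift of [q] to singular vectors. *)
pose pr := projv (singular (e i) A).
pose q1 := (pr \o (p \o pr)^-1 \o q)%VF.
have q1s v : q1 v \in singular (e i) A by rewrite !comp_lfunE memv_proj.
have pq1 v : p (q1 v) = q v.
  have : q v \in limg (p \o pr)%VF.
    have /homP pP := ph; have /singularP[qe qf] := qs v.
    have : q v \in limg p by rewrite p1 memvf.
    case/memv_imgP=> b _ qb; pose a := val (e i) |> b.
    have pa : p a = q v by rewrite pP -qb qe.
    have [||f' f'e|a' a's aa'] :=
      singular_lift He coind_simple (d := e i) (K := lker p) (a := a).
    - exact: submodule_lker.
    - by rewrite -fdactME idemE.
    - by rewrite memv_ker pP pa qf.
    have -> : q v = (p \o pr)%VF a'.
      rewrite comp_lfunE projv_id // -pa; apply/eqP.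
      by rewrite -subr_eq0 -linearB -memv_ker.
    by rewrite memv_img ?memvf.
  by move/limg_lfunVK; rewrite !comp_lfunE.
have [g h x|q2 [q2G q2P]] := average Ge (rho := fun g => fdact A (val g)) q1.
  by rewrite val_maxsubM fdactME.
have q2s v : q2 v \in singular (e i) A.
  have sing (g : maxsub (e i)) : val g |> q1 (g^-1%g |> v) \in singular (e i) A.
    exact: singular_unit.
  apply/singularP; split; last first.
    move=> f' f'e; apply: (q2P _ (fdact A f') v 0) => g.
    by have /singularP[_ ->] := sing g.
  apply/eqP; rewrite -subr_eq0; apply/eqP.
  have := q2P _ (fdact A (val (e i)) - \1%VF)%R v 0.
  rewrite add_lfunE opp_lfunE id_lfunE; apply=> g.
  by rewrite add_lfunE opp_lfunE id_lfunE; have /singularP[-> _] := sing g; rewrite subrr.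
have pq2 v : p (q2 v) = q v.
  apply: q2P => g; have /homP -> := ph; rewrite pq1 -qG.
  by rewrite -fdactME mulgV fdact1E.
have [h [hh hE]] := tensor_lift HM q2G q2s.
exists h; split=> //; apply: tensor_hom_ext => //; first exact: hom_comp hh ph.
by move=> v; rewrite comp_lfunE hE pq2 comp_lfunE.
Qed.

Lemma tensor_projective_cover : is_projective_cover T (sharp V).
Proof.
by split; [apply: tensor_projective | apply: tensor_indecomposable | apply: head_tensor].
Qed.

End CoindSimple.

(** If [W] is a maximal submodule containing all [coind_unit v], the map from
    some [T] onto [Coind V / W] lifts to [Coind V] by projectivity; but then its
    image lies in [W]. *)
Lemma projective_coind_simple :
    (forall (i : 'I_n) (V : fdmodule k (maxsub (e i))),
       simple_module V -> projective (tensor_module HM V)) ->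
  forall (i : 'I_n) (V : fdmodule k (maxsub (e i))),
    simple_module V -> simple_module (Coind V).
Proof.
move=> projT i V sV; apply/(simple_coindP sV) => U HU qU.
apply/eqP/negPn/negP=> U1; have [W mW UW] := maximal_submodule_ex HU U1.
have [HW _ _] := mW; have sS := simple_quotient_module HW mW.
have [j [V' [sV' [[q [qG qs [v0 qv0]]] _]]]] := simple_module_apex He sS.
have [f [fh fE]] := tensor_lift HM qG qs.
have [h [hh hf]] := projT j V' sV' _ _ _ _ (quot_map_hom HW) (quot_map_full HW) fh.
have fv0 : f (tensor_unit HM V' v0) != 0 by rewrite fE.
have h0 : h != 0.
  by apply: contraNneq fv0 => h0; rewrite -hf h0 comp_lfun0r lfunE.
have ij := representatives_inj (tensor_to_coind_greenJ hh h0).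
have hW : h (tensor_unit HM V' v0) \in W.
  have qW v : coind_unit V v \in W by apply/(subvP UW).
  by case: i / ij V sV U HU qU U1 W mW UW HW sS q qG qs qv0 f fh fE h hh hf fv0 h0 qW
    => V sV U HU qU U1 W mW UW HW sS q qG qs qv0 f fh fE h hh hf fv0 h0 qW;
    apply: tensor_to_coind_sub.
by case/eqP: fv0; rewrite -hf comp_lfunE; apply/eqP; rewrite quot_map_eq0.
Qed.

End ProjectiveCovers.

(** * Sandwich matrices *)

Section MonoidAlgebraAction.
Variables (k : fieldType) (T : finMonoidType) (V : fdmodule k T).
Implicit Types (a b : malg k T).

Definition malg_act a : 'End(V) := \sum_t a t *: fdact V t.

Lemma malg_actE a v : malg_act a v = \sum_t a t *: (t |> v).
Proof. by rewrite sum_lfunE; apply: eq_bigr => t _; rewrite scale_lfunE. Qed.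

Lemma malg_act_of t : malg_act (malg_of k t) = fdact V t.
Proof.
apply/lfunP=> v; rewrite malg_actE (bigD1 t) //= ffunE eqxx scale1r big1 ?addr0 //.
by move=> s st; rewrite ffunE (negPf st) scale0r.
Qed.

Lemma malg_act0 : malg_act 0 = 0.
Proof. by rewrite /malg_act big1 // => t _; rewrite ffunE scale0r. Qed.

Lemma malg_actD a b : malg_act (a + b) = malg_act a + malg_act b.
Proof.
by rewrite /malg_act -big_split; apply: eq_bigr => t _; rewrite ffunE scalerDl.
Qed.

Lemma malg_act_sum I (r : seq I) (P : pred I) (F : I -> malg k T) :
  malg_act (\sum_(i <- r | P i) F i) = \sum_(i <- r | P i) malg_act (F i).
Proof. exact: (big_morph _ malg_actD malg_act0). Qed.

Lemma malg_actM a b v : malg_act (a * b) v = malg_act a (malg_act b v).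
Proof.
transitivity (\sum_x \sum_y (a x * b y) *: ((x * y)%g |> v)).
  rewrite malg_actE; under eq_bigr => t _.
    rewrite ffunE scaler_suml; under eq_bigr => x _ do rewrite scaler_suml.
    over.
  rewrite exchange_big; apply: eq_bigr => x _ /=.
  rewrite (exchange_big_dep xpredT) //=; apply: eq_bigr => y _.
  by rewrite (big_pred1 (x * y)%g) // => t; rewrite eq_sym.
rewrite [RHS]malg_actE; apply: eq_bigr => x _; rewrite malg_actE linear_sum scaler_sumr /=.
by apply: eq_bigr => y _; rewrite linearZ scalerA fdactME.
Qed.

End MonoidAlgebraAction.

Section RegularModule.
Variables (k : fieldType) (T : finMonoidType).

Definition regular_act (t : T) : 'End({ffun T -> k^o}) :=
  push k^o (fun s => Some (t * s)%g).

Fact regular_act1 : regular_act 1%g = \1%VF.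
Proof. by apply: lfun_pureP => t w; rewrite push_pure mul1g id_lfunE. Qed.

Fact regular_actM s t : regular_act (s * t)%g = (regular_act s \o regular_act t)%VF.
Proof. by apply: lfun_pureP => u w; rewrite comp_lfunE !push_pure mulgA. Qed.

Definition regular_module : fdmodule k T := FdModule regular_act1 regular_actM.

Lemma malg_act_regular (a : malg k T) (v : regular_module) :
  malg_act regular_module a v = a * (v : malg k T) :> malg k T.
Proof.
rewrite malg_actE; apply/ffunP=> s; rewrite sum_ffunE ffunE; apply: eq_bigr => t _.
by rewrite [fdact _ t v]lfunE !ffunE [LHS]mulr_sumr.
Qed.

End RegularModule.

Section Sandwich.
Variables (k : fieldType) (M : finMonoidType) (e : idem M).
Local Notation E := (val e).
Local Notation J := (Jclass E).

Lemma Rclass_meets_Lclass m : m \in J -> exists r, r \in Rclass E :&: Lclass m.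
Proof.
rewrite inE => Em; have /greenJP[mE /two_sidedP[u [v Euv]]] := Em.
have rR : greenR E (E * u * m)%g.
  apply/greenRP; split; first by exists (u * m)%g; rewrite mulgA.
  by exists v; rewrite -!mulgA (mulgA u) -Euv idemE.
exists (E * u * m)%g; rewrite !inE rR; apply: stable_left.
have /greenRP[_ [y Ey]] := rR.
rewrite -two_sided_sub; apply: (subset_trans (B := two_sided E)); rewrite two_sided_sub //.
by apply/two_sidedP; exists 1%g, y; rewrite mul1g.
Qed.

Lemma Lclass_meets_Rclass m : m \in J -> exists l, l \in Lclass E :&: Rclass m.
Proof.
rewrite inE => Em; have /greenJP[mE /two_sidedP[u [v Euv]]] := Em.
have lL : greenL E (m * (v * E))%g.
  apply/greenLP; split; first by exists (m * v)%g; rewrite mulgA.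
  by exists u; rewrite !mulgA -Euv idemE.
exists (m * (v * E))%g; rewrite !inE lL; apply: stable_right.
have /greenLP[_ [y Ey]] := lL.
rewrite -two_sided_sub; apply: (subset_trans (B := two_sided E)); rewrite two_sided_sub //.
by apply/two_sidedP; exists y, 1%g; rewrite mulg1.
Qed.

Lemma reps_ex : exists rho lam : {set M} -> M, Rclass_reps e rho /\ Lclass_reps e lam.
Proof.
exists (fun a => odflt 1%g [pick x in Lclass E :&: a]).
exists (fun b => odflt 1%g [pick x in Rclass E :&: b]).
split=> _ /imsetP[m mJ ->]; case: pickP => // no.
  by have [l] := Lclass_meets_Rclass mJ; rewrite no.
by have [r] := Rclass_meets_Lclass mJ; rewrite no.
Qed.

Variables rho lam : {set M} -> M.
Hypotheses (rhoP : Rclass_reps e rho) (lamP : Lclass_reps e lam).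
Local Notation A := #|Rclasses J|.
Local Notation B := #|Lclasses J|.
Local Notation P := (sandwich k e rho lam).
Let rh (a : 'I_A) := rho (enum_val a).
Let la (b : 'I_B) := lam (enum_val b).

Lemma lamR b : greenR E (la b).
Proof. by have := lamP (enum_valP b); rewrite !inE => /andP[]. Qed.

Lemma lam_class b : la b \in enum_val b.
Proof. by have := lamP (enum_valP b); rewrite inE => /andP[]. Qed.

Lemma lam_classE b : enum_val b = Lclass (la b).
Proof.
have := lam_class b; have /imsetP[m _ ->] := enum_valP b.
by rewrite inE => /eqP ml; apply/setP=> x; rewrite !inE /greenL ml.
Qed.

Lemma rhoL a : greenL E (rh a).
Proof. by have := rhoP (enum_valP a); rewrite !inE => /andP[]. Qed.

Lemma rhoE a : (rh a * E)%g = rh a.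
Proof. by have /greenLP[[x ->] _] := rhoL a; rewrite -mulgA idemE. Qed.

Lemma Rclass_decomp r : greenR E r -> exists b (g : maxsub e), r = (val g * la b)%g.
Proof.
move=> rR; have rJ : r \in J.
  have /greenRP[[x xE] [y yE]] := rR; rewrite inE; apply/greenJP.
  by split; apply/two_sidedP; [exists 1%g, x | exists 1%g, y]; rewrite mul1g.
have rB : Lclass r \in Lclasses J by apply/imset_f.
exists (enum_rank_in rB (Lclass r)); have lR := lamR (enum_rank_in rB (Lclass r)).
have := lam_class (enum_rank_in rB (Lclass r)).
rewrite (enum_rankK_in rB rB) inE => /greenLP[_ [x rx]].
set l := la _ in lR rx *; have El := Rclass_idl lR.
have gl : (E * x * E * l = r)%g.
  by rewrite -!mulgA El -rx Rclass_idl.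
have gU : (E * x * E)%g \in units_at E.
  apply/units_atP; split; first by rewrite -mulgA idemE.
  have /greenRP[_ [y yE]] := rR; apply/greenRP; split.
    by exists (x * E)%g; rewrite mulgA.
  by exists (l * y)%g; rewrite mulgA gl.
by exists (Sub (E * x * E)%g gU); rewrite SubK gl.
Qed.

Lemma Lclass_decomp l : greenL E l -> exists a (g : maxsub e), l = (rh a * val g)%g.
Proof.
move=> lL; have /greenLP[[z zE] [w wE]] := lL.
have lJ : l \in J.
  rewrite inE; apply/greenJP.
  by split; apply/two_sidedP; [exists z, 1%g | exists w, 1%g]; rewrite mulg1.
have lA : Rclass l \in Rclasses J by apply/imset_f.
have lE : (l * E = l)%g by rewrite zE -mulgA idemE.
exists (enum_rank_in lA (Rclass l)); have rE := rhoE (enum_rank_in lA (Rclass l)).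
have : rh (enum_rank_in lA (Rclass l)) \in Rclass l.
  have := rhoP (enum_valP (enum_rank_in lA (Rclass l))).
  by rewrite -/(rh _) inE (enum_rankK_in lA lA) => /andP[].
rewrite inE => /greenRP[_ [x rx]].
set r := rh _ in rE rx *.
have rh' : (r * (E * x * E) = l)%g by rewrite !mulgA rE -rx lE.
have yh : (E * w * r * (E * x * E) = E)%g.
  by rewrite -mulgA rh' -mulgA -wE idemE.
have yU : (E * w * r)%g \in units_at E.
  apply/units_atP; split; first by rewrite -mulgA rE.
  apply/greenRP; split; first by exists (w * r)%g; rewrite mulgA.
  by exists (E * x * E)%g.
exists ((Sub (E * w * r)%g yU : maxsub e)^-1)%g.
set y : maxsub e := Sub _ _; have yE : val y = (E * w * r)%g by rewrite SubK.
rewrite -[LHS]rh'; congr (_ * _)%g.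
transitivity (val y^-1 * (val y * (E * x * E)))%g; last by rewrite yE yh unit_mulr.
by rewrite mulgA -val_maxsubM mulVg val_maxsub1 !mulgA idemE.
Qed.

(** The sandwich matrix is the matrix of the map sending [rho_a (x) v] to
    [rho_a coind_unit(v)], in the coordinates [cev lambda_b] of [Coind V]. *)
Lemma cev_rho_coind_unit (V : fdmodule k (maxsub e)) b a v :
  cev (la b) (rh a |> coind_unit V v) = malg_act V (P b a) v.
Proof.
rewrite cev_act ?lamR // mxE -/(la b) -/(rh a).
have lr : (la b * rh a * E)%g = (la b * rh a)%g by rewrite -mulgA rhoE.
case: insubP => [g gU gE|nU].
  rewrite malg_act_of cev_coind_unit; last by have /units_atP[] := gU.
  by rewrite lr -gE unit_actE.
by rewrite malg_act0 cev_out ?lfunE //; apply: contra nU => lrR; apply/units_atP.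
Qed.

Lemma coind_lam_inj (V : fdmodule k (maxsub e)) (s t : Coind V) :
  (forall b, cev (la b) s = cev (la b) t) -> s = t.
Proof.
move=> st; apply: cev_inj => r; have [rR|rR] := boolP (greenR E r); last by rewrite !cev_out.
have [b [g ->]] := Rclass_decomp rR.
by rewrite !cev_act_unit ?st // Rclass_idl ?lamR.
Qed.

(** A right inverse [Q] gives the formula
    [t = \sum_(a, b) rho_a coind_unit(Q(a,b) t(lambda_b))]. *)
Lemma right_invertible_coind_simple (V : fdmodule k (maxsub e)) :
  right_invertible P -> simple_module V -> simple_module (Coind V).
Proof.
case=> Q PQ sV; apply/(simple_coindP sV) => U /submoduleP HU qU.
apply/eqP; rewrite eqEsubv subvf; apply/subvP=> t _.
pose w a b := rh a |> coind_unit V (malg_act V (Q a b) (cev (la b) t)).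
have -> : t = \sum_a \sum_b w a b.
  apply: coind_lam_inj => b.
  transitivity (\sum_b' malg_act V ((P *m Q) b b') (cev (la b') t)).
    rewrite PQ (bigD1 b) //= mxE eqxx mulr1n malg_act_of fdact1E big1 ?addr0 // => b' b'b.
    by rewrite mxE eq_sym (negPf b'b) malg_act0 lfunE.
  rewrite linear_sum /=; under [RHS]eq_bigr => a _ do rewrite linear_sum.
  rewrite exchange_big; apply: eq_bigr => b' _ /=.
  rewrite mxE malg_act_sum sum_lfunE; apply: eq_bigr => a _.
  by rewrite malg_actM cev_rho_coind_unit.
by apply: memv_suml => a _; apply: memv_suml => b _; apply: HU.
Qed.

(** The submodule generated by the vectors [coind_unit v] (a submodule because
    [x coind_unit(v) = 0] unless [x e] is in [L_e]). *)
Definition rho_span (V : fdmodule k (maxsub e)) : {vspace Coind V} :=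
  (\sum_a (fdact (Coind V) (rh a) @: limg (coind_unit V)))%VS.

Lemma rho_span_act (V : fdmodule k (maxsub e)) x v : x |> coind_unit V v \in rho_span V.
Proof.
have /singularP[ev _] := coind_unit_singular v.
rewrite -ev -fdactME; have [xL|xL] := boolP (greenL E (x * E)%g).
  have [a [g ->]] := Lclass_decomp xL.
  rewrite fdactME -coind_unit_equivariant; apply: (subvP (sumv_sup a _ (subvv _))) => //.
  by rewrite !memv_img ?memvf.
suff -> : (x * E)%g |> coind_unit V v = 0 by apply: mem0v.
apply: cev_inj => r; rewrite linear0.
have [rR|rR] := boolP (greenR E r); last exact: cev_out.
rewrite cev_act //; apply: cev_out; apply: contra xL => rxR.
have rxU : (r * (x * E))%g \in units_at E by apply/units_atP; rewrite -!mulgA idemE.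
have /unitsP[_ [y [_ _ yE]]] := rxU.
apply/greenLP; split; first by exists x.
by exists (y * r)%g; rewrite -mulgA yE.
Qed.

Lemma rho_span_submodule (V : fdmodule k (maxsub e)) : is_submodule (rho_span V).
Proof.
apply/submoduleP=> m s /memv_sumP[f fE ->]; rewrite linear_sum; apply: memv_suml => a _ /=.
have /memv_imgP[_ /memv_imgP[v _ ->] ->] := fE a isT.
by have := rho_span_act (m * rh a)%g v; rewrite fdactME.
Qed.

(** The [b]-th coordinate function [d], equal to 1 at [lambda_b] and to 0 at the
    other [lambda_b'], is a sum of vectors [rho_a coind_unit(q_a)]; the
    coefficients [q_a] form the [b]-th column of a right inverse. *)
Lemma coind_span_right_invertible :
  (forall U : {vspace Coind (regular_module k (maxsub e))}, is_submodule U ->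
     (forall v, coind_unit _ v \in U) -> U = fullv) ->
  right_invertible P.
Proof.
set V := regular_module k (maxsub e) => full.
have col (b : 'I_B) : exists q : 'I_A -> malg k (maxsub e),
    forall b', \sum_a P b' a * q a = (b' == b)%:R.
  have /greenRP[_ [y yE]] := lamR b.
  pose one : V := malg_one k (maxsub e).
  (* [r * y] is the element [g] of the group such that [r = g lambda_b]. *)
  pose F r : V := if greenL (la b) r then unit_act V (r * y)%g one else 0.
  have [g r rR|d dE] := coind_ex (F := F).
    have gL : greenL (la b) (val g * r)%g = greenL (la b) r.
      rewrite /greenL; congr (_ == _); apply/eqP; apply/greenLP; split.
        by exists (val g^-1)%g; rewrite mulgA -val_maxsubM mulVg Rclass_idl.
      by exists (val g).
    rewrite /F gL; case: ifP => _; last by rewrite linear0.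
    by rewrite -mulgA unit_act_mul // mulgA Rclass_idl.
  have : d \in rho_span V.
    rewrite (full (rho_span V)) ?memvf //; first exact: rho_span_submodule.
    move=> v; rewrite -[X in X \in _]fdact1E; exact: rho_span_act.
  case/memv_sumP=> f fE dsum.
  have [q qE] : exists q : 'I_A -> V, forall a, f a = rh a |> coind_unit V (q a).
    apply: (fin_all_exists (P := fun a q => f a = rh a |> coind_unit V q)) => a.
    by have /memv_imgP[_ /memv_imgP[v _ ->] ->] := fE a isT; exists v.
  exists q => b'; transitivity (cev (la b') d : malg k _).
    rewrite dsum linear_sum; apply: eq_bigr => a _ /=.
    by rewrite qE (@cev_rho_coind_unit V) malg_act_regular.
  rewrite dE ?lamR // /F; have [->|b'b] := eqVneq b' b.
    by rewrite /greenL eqxx -yE (unit_actE V 1%g) fdact1E.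
  case: ifP => // /eqP bb'; case/eqP: b'b; apply: enum_val_inj.
  by rewrite !lam_classE; apply/setP=> x; rewrite !inE /greenL bb'.
have [q qE] := fin_all_exists col.
exists (\matrix_(a, b) q b a); apply/matrixP=> b' b; rewrite !mxE -qE.
by apply: eq_bigr => a _; rewrite [X in _ * X]mxE.
Qed.
End Sandwich.

(** * Semisimplicity of the group algebra *)

Section CoindSpan.
Variables (k : fieldType) (M : finMonoidType) (e : idem M).
Hypothesis Ge : (#|{: maxsub e}|%:R : k) != 0.
Hypothesis coind_simple : forall V : fdmodule k (maxsub e),
  simple_module V -> simple_module (Coind V).

Lemma equivariant_projection (V : fdmodule k (maxsub e)) (U : {vspace V}) :
  is_submodule U -> exists q : 'End(V),
    [/\ is_hom q, forall v, q v \in U & forall u, u \in U -> q u = u].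
Proof.
move=> /submoduleP HU.
have [g h x|q [qG qP]] := average Ge (rho := fdact V) (projv U).
  by rewrite fdactME.
exists q; split; first by apply/homP.
  move=> v; have : (\1 - projv U)%VF (q v) = 0.
    apply: qP => g; rewrite add_lfunE opp_lfunE id_lfunE [projv U (g |> _)]projv_id ?subrr //.
    by apply: HU; apply: memv_proj.
  rewrite add_lfunE opp_lfunE id_lfunE => /eqP; rewrite subr_eq0 => /eqP->.
  exact: memv_proj.
move=> u uU; rewrite -[LHS]id_lfunE; apply: qP => g.
by rewrite id_lfunE projv_id ?HU // -fdactME mulgV fdact1E.
Qed.

(** The vectors [coind_unit u], [u] in [U], generate the functions with values in
    [U]. For simple [U] this is simplicity of [Coind U]; in general a function is
    split along a decomposition of [U] given by an equivariant projection. *)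
Lemma coind_span (V : fdmodule k (maxsub e)) (X : {vspace Coind V}) (U : {vspace V})
    (s : Coind V) :
    is_submodule X -> is_submodule U -> (forall u, u \in U -> coind_unit V u \in X) ->
    (forall r, cev r s \in U) ->
  s \in X.
Proof.
move=> HX; have [m] := ubnP (\dim U); elim: m U s => // m IH U s dU HU UX sU.
have [U0|U0] := eqVneq U 0%VS.
  suff -> : s = 0 by apply: mem0v.
  by apply: cev_inj => r; apply/eqP; rewrite linear0 -memv0 -U0.
have [sS|nS] := classic (simple_submodule U).
  have sW := simple_sub_module HU sS.
  have [Q [Qh QE]] := coind_map (sub_incl_hom HU).
  have full : (Q @^-1: X)%VS = fullv.
    apply: (iffLR (simple_coindP sW) (coind_simple sW)); first exact: submodule_preim.
    by move=> w; rewrite -memv_preim (coind_map_unit _ Qh QE) UX // sub_inclE subvsP.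
  have [g r rR|s' s'E] :=
    coind_ex (V := submodule_module HU) (F := fun r => vsproj U (cev r s)).
    have /homP iP := sub_incl_hom HU.
    apply: subvs_inj; rewrite -[RHS]sub_inclE iP !sub_inclE !vsprojK //.
    by rewrite cev_act_unit // Rclass_idl.
  have -> : s = Q s'.
    apply: cev_inj => r; have [rR|rR] := boolP (greenR (val e) r); last by rewrite !cev_out.
    by rewrite QE s'E // sub_inclE vsprojK.
  by rewrite memv_preim full memvf.
have [U' HU' [U'U U'0 ltU']] := nonsimple_submodule HU U0 nS.
have [q [qh qU' qid]] := equivariant_projection HU'.
have [Q [Qh QE]] := coind_map qh.
rewrite -(subrK (Q s) s); apply: memvD; last first.
  apply: (IH U') => //; first exact: leq_trans ltU' (dU : (_ <= m)%N).
    by move=> u /(subvP U'U)/UX.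
  by move=> r; rewrite QE.
apply: (IH (U :&: lker q)%VS).
- apply: leq_trans (dU : (_ <= m)%N); rewrite ltn_neqAle dimvS ?capvSl // andbT.
  rewrite (dimv_leqif_eq (capvSl _ _)); apply: contraNneq U'0 => UK.
  rewrite -subv0; apply/subvP=> u u1; rewrite memv0.
  have : u \in (U :&: lker q)%VS by rewrite UK (subvP U'U).
  by rewrite memv_cap memv_ker qid // => /andP[].
- apply/submoduleP=> t u; rewrite !memv_cap => /andP[uU uK].
  by rewrite (submoduleP _ HU) // (submoduleP _ (submodule_lker qh)).
- by move=> u; rewrite memv_cap => /andP[/UX].
move=> r; rewrite linearB /= QE memv_cap memvB ?(subvP U'U _ (qU' _)) //=.
by rewrite memv_ker linearB /= (qid _ (qU' _)) subrr.
Qed.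

End CoindSpan.

Theorem theorem4p7 (M : finMonoidType) (HM : right_fountain M) (k : fieldType)
    (Hchar : forall (e : idem M) (p : nat),
      p \in [pchar k] -> ~~ (p %| #|{: maxsub e}|)%N)
    (n : nat) (e : 'I_n -> idem M) (He : regularJ_representatives e) :
  [<->
    (* (1) *)
    forall (i : 'I_n) (rho lam : {set M} -> M),
      Rclass_reps (e i) rho -> Lclass_reps (e i) lam ->
      right_invertible (sandwich k (e i) rho lam);
    (* (2) *)
    forall (i : 'I_n) (V : fdmodule k (maxsub (e i))),
      simple_module V -> simple_module (Coind V);
    (* (3) *)
    forall (i : 'I_n) (V : fdmodule k (maxsub (e i))),
      simple_module V -> is_projective_cover (tensor_module HM V) (sharp V) ].
Proof.
have G0 (d : idem M) : (#|{: maxsub d}|%:R : k) != 0.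
  have G1 : (0 < #|{: maxsub d}|)%N by apply/card_gt0P; exists 1%g.
  apply/negP=> G00; have [p pk] := natf0_pchar G1 G00.
  by have := Hchar d _ pk; rewrite (dvdn_pcharf pk) G00.
tfae.
- move=> H1 i V; have [rho [lam [rhoP lamP]]] := reps_ex (e i).
  exact/(right_invertible_coind_simple rhoP lamP)/H1.
- by move=> H2 i V sV; apply: tensor_projective_cover.
move=> H3; have H2 := projective_coind_simple He
  (fun i V sV => let: And3 p _ _ := H3 i V sV in p).
move=> i rho lam rhoP lamP; apply: (coind_span_right_invertible rhoP lamP) => U HU qU.
apply/eqP; rewrite eqEsubv subvf; apply/subvP=> s _.
apply: (coind_span (G0 (e i)) (H2 i) HU (submodule_full _)) => // r.
exact: memvf.
Qed.
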